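(* Let $n\ge2$, $B_\infty^n=\{x\in\mathbb{R}^n:\max_{1\le i\le n}|x_i|\le1\}$ and $B_1^n=\{x\in\mathbb{R}^n:\sum_{i=1}^n|x_i|\le1\}$. Then $$\lim_{\delta\rightarrow0^+}\frac{d_{B_\infty^n}(\delta)-1}{\delta^{1/n}}=\frac{\sqrt[n]{n!}}{n}\qquad\text{and}\qquad\lim_{\delta\rightarrow0^+}\frac{d_{B_1^n}(\delta)-1}{\delta^{1/n}}=\frac{2^{1/n}}{2}.$$
   Context: $|A|_n$ denotes $n$-dimensional volume and $\mathrm{conv}[K,x]$ the convex hull of $K\cup\{x\}$. For a convex body $K\subseteq\mathbb{R}^n$ (compact, convex, non-empty interior) and $\delta\ge0$: the convex floating body is $K_\delta=\bigcap_{|K\cap H^-|_n\le\delta|K|_n}H^+$, the intersection being over all hyperplanes $H$ with closed half-spaces $H^+,H^-$ such that $|K\cap H^-|_n\le\delta|K|_n$; the illumination body is $K^\delta=\{x\in\mathbb{R}^n:|\mathrm{conv}[K,x]|_n\le(1+\delta)|K|_n\}$. If $0\in\mathrm{int}\,K$, the polar is $K^\circ=\{y\in\mathbb{R}^n:\langle x,y\rangle\le1\text{ for all }x\in K\}$. For a centrally symmetric convex body $S$ ($S=-S$) and $\delta'>0$ put $\langle S\rangle^{\delta'}=((S^\circ)^{\delta'})^\circ$. For centrally symmetric convex bodies $S_1,S_2$ let $d(S_1,S_2)=\inf\{a\ge1:\frac1aS_1\subseteq S_2\subseteq aS_1\}$. For a centrally symmetric convex body $S$ and $0<\delta<\frac12$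 put $d_S(\delta)=\inf_{\delta'>0}d\left(S_\delta,\langle S\rangle^{\delta'}\right)$. *)

(* Defs.v *)
From mathcomp Require Import all_boot all_order all_algebra.
From mathcomp Require Import all_classical all_reals all_analysis.
Import Order.TTheory GRing.Theory Num.Theory.
Import numFieldNormedType.Exports.

Set Implicit Arguments.
Unset Strict Implicit.
Unset Printing Implicit Defensive.

Local Open Scope classical_set_scope.
Local Open Scope ring_scope.

Section Volume.
Variable R : realType.

(* On Borel sets, the n-dimensional Lebesgue measure. *)
Fixpoint lebesgue_tuple (n : nat) : set (n.-tuple R) -> \bar R :=
  match n with
  | 0 => \d_ [tuple]
  | m.+1 => pushforward (lebesgue_measure \x @lebesgue_tuple m)%E
              (fun p : R * m.-tuple R => [tuple of p.1 :: p.2])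
  end.

Definition volume (n : nat) (A : set 'rV[R]_n) : \bar R :=
  lebesgue_tuple [set t : n.-tuple R | A (\row_i tnth t i)].

End Volume.

Section ConvexBodies.
Variables (R : realType) (n : nat).
Implicit Types (x y u : 'rV[R]_n) (K S : set 'rV[R]_n).

Definition dot x y : R := \sum_(i < n) x 0 i * y 0 i.

Definition convex_hull (A : set 'rV[R]_n) : set 'rV[R]_n :=
  smallest (@convex_set R 'rV[R]_n) A.

(* A hyperplane {x | <x, u> = c} with a choice of its two sides is a pair
   (u, c), u != 0; (- u, - c) is the same hyperplane with the sides swapped. *)
Definition halfspace_neg u (c : R) : set 'rV[R]_n := [set x | c <= dot x u].
Definition halfspace_pos u (c : R) : set 'rV[R]_n := [set x | dot x u <= c].

Definition floating_body K (delta : R) : set 'rV[R]_n :=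
  \bigcap_(H in [set H : 'rV[R]_n * R | H.1 != 0 /\
      (volume (K `&` halfspace_neg H.1 H.2) <= delta%:E * volume K)%E])
    halfspace_pos H.1 H.2.

Definition illumination_body K (delta : R) : set 'rV[R]_n :=
  [set x | (volume (convex_hull (K `|` [set x]))
            <= (1 + delta)%:E * volume K)%E].

Definition polar K : set 'rV[R]_n := [set y | forall x, K x -> dot x y <= 1].

Definition polar_illumination_body S (delta : R) : set 'rV[R]_n :=
  polar (illumination_body (polar S) delta).

Definition dilate (a : R) S : set 'rV[R]_n := [set a *: x | x in S].

(* In \bar R the infimum of the empty set is +oo; for convex bodies containing
   0 in their interiors the value is a real number. *)
Definition dist_body (S1 S2 : set 'rV[R]_n) : \bar R :=
  ereal_inf [set a%:E | a in [set a : R |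
    [/\ 1 <= a, dilate a^-1 S1 `<=` S2 & S2 `<=` dilate a S1]]].

Definition dist_floating_illumination S (delta : R) : \bar R :=
  ereal_inf [set dist_body (floating_body S delta)
                           (polar_illumination_body S delta')
            | delta' in [set delta' : R | 0 < delta']].

End ConvexBodies.

Definition cube (R : realType) (n : nat) : set 'rV[R]_n :=
  [set x | \big[Num.max/0]_(i < n) `|x 0 i| <= 1].

Definition cross_polytope (R : realType) (n : nat) : set 'rV[R]_n :=
  [set x | \sum_(i < n) `|x 0 i| <= 1].

Arguments cube : clear implicits.
Arguments cross_polytope : clear implicits.

(* Main.v *)
Require Import Defs.
From HB Require Import structures.
From mathcomp Require Import all_boot all_order all_algebra.
From mathcomp Require Import all_classical all_reals all_analysis.
From mathcomp Require Import measurable_realfun.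
From mathcomp Require Import perm ring lra.
Import Order.TTheory GRing.Theory Num.Theory.
Import numFieldNormedType.Exports.

Set Implicit Arguments.
Unset Strict Implicit.
Unset Printing Implicit Defensive.

Local Open Scope classical_set_scope.
Local Open Scope ring_scope.

(** Write [s = delta ^ (1 / n)], let [S] be the cube or the cross-polytope, [F]
    its floating body and [P] the polar of the illumination body, of parameter
    [delta'], of the polar of [S].

    Near a vertex [v] of [S], the floating body is cut at depth [a s], in the
    sense that [(1 - a s) v] is essentially its boundary point: the cap that a
    hyperplane must cut off has volume [delta |S|], and cutting a corner at depth
    [h] costs a volume of order [h^n]. For the cube,
    [(n a)^n = n! 2^n] ([floating_cube_cap], and [volume_cube_cut] for the
    converse, by the inequality of arithmetic and geometric means). For the
    cross-polytope, [a^n = 2] ([floating_cross_cap], and [volume_cross_cut] for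
    the converse, by a point reflection). In every other direction the floating
    body is at distance [o(s)] from the boundary of [S].

    The polar of the illumination body behaves differently. A point above the
    relative interior of a facet of a polytope [K] adds a single pyramid to the
    convex hull ([volume_hull_ge], [volume_hull_le]), so there the boundary of the
    illumination body of [K] is the facet pushed outwards. Dually, [P] coincides
    in first order with [S / (1 + q)] in the direction of [v], where [q] is a
    multiple of [delta'], and this persists in the directions that are close to,
    but different from, that of [v].

    Comparing both bodies in direction [v], where the radii are [1 - a s] and
    [1 / (1 + q)], and in a nearby direction, where they are [1 - o(s)] and
    [1 / (1 + q)], the distance is at least about
    [1 + max (a s - q, q) >= 1 + a s / 2]. The choice [q = a s / 2] attains this
    bound. So both limits are [a / 2]. The lower bounds are [cube_distance_ge] and
    [cross_distance_ge], the upper bounds [cube_distance_le] and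
    [cross_distance_le].

    The volumes are computed from the iterated integral through the formula for
    affine substitutions, [volume_affine]. The volume is monotone on arbitrary
    sets ([le_volume]), so a convex hull is estimated by comparing it with
    measurable sets on either side. *)

(** * The volume as a product measure *)

Section lebesgue_tuple_measure.
Context {R : realType}.
Local Open Scope ereal_scope.
Local Notation tup n := (n.-tuple (measurableTypeR R)).

Let cons_tuple n (p : R * n.-tuple R) : n.+1.-tuple R := [tuple of p.1 :: p.2].

Let measurable_cons_tuple n :
  measurable_fun [set: measurableTypeR R * tup n] (@cons_tuple n).
Proof. exact: measurable_cons. Qed.

Let lebesgue_tuple_axioms n :
  [/\ @lebesgue_tuple R n set0 = 0, forall A, 0 <= @lebesgue_tuple R n A,
      @semi_sigma_additive _ R (tup n) (@lebesgue_tuple R n) &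
      @sigma_finite _ (tup n) R setT (@lebesgue_tuple R n)].
Proof.
elim: n => [|n [l0 lge0 ladd lfin]].
  pose D := (@dirac _ (tup 0) [tuple] R : {measure set (tup 0) -> \bar R}).
  split; [exact: (measure0 D)|exact: (measure_ge0 D)|
    exact: (@measure_semi_sigma_additive _ _ _ D)|].
  exists (fun=> setT) => [|i]; first by rewrite bigcup_const.
  split => //; have : D setT < +oo by rewrite /D/= diracT ltry.
  by [].
pose m1 := isMeasure.Build _ (tup n) R _ l0 lge0 ladd.
pose M1 : {measure set (tup n) -> \bar R} := HB.pack (@lebesgue_tuple R n) m1.
pose m2 := Measure_isSigmaFinite.Build _ (tup n) R M1 lfin.
pose M : {sigma_finite_measure set (tup n) -> \bar R} :=
  HB.pack (@lebesgue_tuple R n) m1 m2.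
pose PM : {measure set _ -> \bar R} := (lebesgue_measure \x M).
have mpre A : measurable (A : set (tup n.+1)) -> measurable (@cons_tuple n @^-1` A).
  by move=> mA; rewrite -[X in measurable X]setTI; exact: measurable_cons_tuple.
have lE A : lebesgue_tuple A = PM (@cons_tuple n @^-1` A) by [].
split.
- by rewrite lE preimage_set0 measure0.
- by move=> A; rewrite lE measure_ge0.
- move=> F mF tF mUF; rewrite lE preimage_bigcup.
  apply: (@measure_semi_sigma_additive _ _ _ PM (fun n0 => @cons_tuple n @^-1` F n0)) =>
      [i|//|//].
  + exact: mpre.
  + apply/trivIsetP => /= i j _ _ ij; rewrite -preimage_setI.
    by move/trivIsetP : tF => /(_ _ _ _ _ ij) ->//; rewrite preimage_set0.
  + by rewrite -preimage_bigcup; exact: mpre.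
have /sigma_finiteP[F [TF ndF Foo]] := sigma_finiteT (@lebesgue_measure R).
have /sigma_finiteP[G [TG ndG Goo]] := sigma_finiteT M.
pose hd (t : tup n.+1) : measurableTypeR R := thead t.
pose tl (t : tup n.+1) : tup n := [tuple of behead t].
have mhd : measurable_fun [set: tup n.+1] hd.
  exact: (@measurable_tnth _ (measurableTypeR R) n.+1 ord0).
have mtl : measurable_fun [set: tup n.+1] tl by exact: measurable_behead.
exists (fun k => hd @^-1` F k `&` tl @^-1` G k) => [|k].
  apply/seteqP; split => // t _.
  have : [set: R] (hd t) by []. rewrite TF => -[i _ Fi].
  have : [set: tup n] (tl t) by []. rewrite TG => -[j _ Gj].
  exists (maxn i j) => //; split => /=.
    by move: Fi; exact/subsetPset/ndF/leq_maxl.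
  by move: Gj; exact/subsetPset/ndG/leq_maxr.
have [mF Foo'] := Foo k; have [mG Goo'] := Goo k.
split; first by apply: measurableI; rewrite -[X in measurable X]setTI; [exact: mhd|exact: mtl].
rewrite lE.
have -> : @cons_tuple n @^-1` (hd @^-1` F k `&` tl @^-1` G k) = F k `*` G k.
  have tlE x t : tl (cons_tuple (x, t)) = t by apply: val_inj.
  by apply/seteqP; split => -[x t]; rewrite /preimage/= tlE /hd theadE.
rewrite [ltLHS](@product_measure1E _ _ _ _ _ lebesgue_measure M) //.
by rewrite lte_mul_pinfty// ge0_fin_numE.
Qed.

Definition tuple_measure n : {sigma_finite_measure set (tup n) -> \bar R} :=
  let: And4 l0 lge0 ladd lfin := lebesgue_tuple_axioms n in
  let m1 := isMeasure.Build _ (tup n) R (@lebesgue_tuple R n) l0 lge0 ladd in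
  let M1 : {measure set (tup n) -> \bar R} := HB.pack (@lebesgue_tuple R n) m1 in
  let m2 := Measure_isSigmaFinite.Build _ (tup n) R M1 lfin in
  HB.pack (@lebesgue_tuple R n) m1 m2.

Lemma tuple_measureE n A : tuple_measure n A = @lebesgue_tuple R n A.
Proof. by rewrite /tuple_measure; case: lebesgue_tuple_axioms. Qed.

End lebesgue_tuple_measure.

(** * Integrals on the line *)

Section affine_line.
Context {R : realType}.
Local Open Scope ereal_scope.
Local Notation lambda := (@lebesgue_measure R).
Import HBNNSimple.

(** The integral of a nonnegative function is a supremum over the simple
    functions below it, so monotonicity holds for arbitrary functions. This makes
    the volume monotone on arbitrary sets, in particular on convex hulls. *)
Lemma ge0_le_integralT d (T : measurableType d) (mu : {measure set T -> \bar R})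
    (f g : T -> \bar R) :
  (forall x, 0 <= f x) -> (forall x, f x <= g x) ->
  \int[mu]_x f x <= \int[mu]_x g x.
Proof.
move=> f0 fg; have g0 x : 0 <= g x := le_trans (f0 x) (fg x).
rewrite !ge0_integralTE//; apply: ereal_sup_le => _ [h hf <-].
by exists h => // x; apply: le_trans (fg x).
Qed.

(** Both sides are integrals for two measures, the second being a scaled image of
    the first, that agree on intervals. *)
Lemma integral_affine (a b : R) (f : R -> \bar R) : a != 0%R ->
  measurable_fun [set: R] f -> (forall x, 0 <= f x) ->
  \int[lambda]_x f (x * a + b)%R = `|a|^-1%:E * \int[lambda]_x f x.
Proof.
move=> a0 mf f0.
pose g : measurableTypeR R -> measurableTypeR R := fun x => (x * a + b)%R.
have mg : measurable_fun [set: measurableTypeR R] g.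
  by apply: measurable_funD => //; apply: measurable_funM.
have a_ge0 : (0 <= `|a|)%R by [].
pose nu : {measure set (measurableTypeR R) -> \bar R} :=
  measure_function_pushforward__canonical__measure_function_Measure lambda mg.
pose mu : {measure set (measurableTypeR R) -> \bar R} := mscale (NngNum a_ge0) nu.
have muE A : measurable A -> lambda A = mu A.
  apply: lebesgue_measure_unique => _ [[c d] _ <-].
  rewrite /mu/= /mscale/= /nu/= /pushforward.
  have [a_gt0|a_lt0|/eqP] := ltgtP a 0%R; last by rewrite (negbTE a0).
    have -> : g @^-1` `]c, d]%classic = `[((d - b) / a)%R, ((c - b) / a)%R[%classic.
      apply/seteqP; split => x; rewrite /preimage/= !in_itv/= /g ler_ndivrMr// ltr_ndivlMr//;
      by rewrite ltrBlDr lerBrDr andbC.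
    rewrite !lebesgue_measure_itv/= !lte_fin ltr_nM2r ?invr_lt0// ltrD2r.
    case: ifPn; last by rewrite mule0.
    by rewrite -!EFinD -EFinM => _; congr EFin; rewrite ltr0_norm//; field.
  have -> : g @^-1` `]c, d]%classic = `]((c - b) / a)%R, ((d - b) / a)%R]%classic.
    apply/seteqP; split => x; rewrite /preimage/= !in_itv/= /g ler_pdivlMr// ltr_pdivrMr//;
    by rewrite ltrBlDr lerBrDr.
  rewrite !lebesgue_measure_itv/= !lte_fin ltr_pM2r ?invr_gt0// ltrD2r.
  case: ifPn; last by rewrite mule0.
  by rewrite -!EFinD -EFinM => _; congr EFin; rewrite gtr0_norm//; field.
rewrite [in RHS](@eq_measure_integral _ _ _ setT mu lambda); last by move=> A mA _; exact: muE.
rewrite ge0_integral_mscale//= muleA -EFinM mulVf ?normr_eq0// mul1e.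
by rewrite (@ge0_integral_pushforward _ _ _ _ _ g mg lambda setT f)//= preimage_setT.
Qed.

End affine_line.

(** * Borel sets of row vectors and slices *)

Section volume_theory.
Context {R : realType}.
Local Notation tup n := (n.-tuple (measurableTypeR R)).

Definition tuple_row n (t : n.-tuple R) : 'rV[R]_n := \row_i tnth t i.

Definition borel n (A : set 'rV[R]_n) : Prop :=
  measurable (@tuple_row n @^-1` A : set (tup n)).

Lemma volumeE n (A : set 'rV[R]_n) :
  volume A = tuple_measure n (@tuple_row n @^-1` A).
Proof. by rewrite tuple_measureE. Qed.

Lemma volume_ge0 n (A : set 'rV[R]_n) : (0 <= volume A)%E.
Proof. by rewrite volumeE measure_ge0. Qed.

Lemma borelI n (A B : set 'rV[R]_n) : borel A -> borel B -> borel (A `&` B).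
Proof. exact: measurableI. Qed.

Lemma borelC n (A : set 'rV[R]_n) : borel A -> borel (~` A).
Proof. exact: measurableC. Qed.

Lemma borel_forall n (I : finType) (A : I -> set 'rV[R]_n) :
  (forall i, borel (A i)) -> borel [set x | forall i, A i x].
Proof.
move=> mA; rewrite /borel.
have -> : @tuple_row n @^-1` [set x | forall i, A i x] =
    \big[setI/setT]_(i <- enum I) (@tuple_row n @^-1` A i).
  rewrite -bigcap_seq; apply/seteqP; split => t H i; first by move=> _; exact: H.
  by apply: H; rewrite /= mem_enum.
by apply: bigsetI_measurable => i _; exact: mA.
Qed.

Definition borel_fun n (f : 'rV[R]_n -> R) : Prop :=
  measurable_fun [set: tup n] (f \o @tuple_row n : _ -> measurableTypeR R).

Lemma borel_fun_cst n (c : R) : borel_fun (fun _ : 'rV[R]_n => c).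
Proof. exact: measurable_cst. Qed.

Lemma borel_fun_coord n i : borel_fun (fun x : 'rV[R]_n => x 0 i).
Proof.
rewrite /borel_fun (_ : _ \o _ = fun t : tup n => tnth t i); last first.
  by apply/funext => t /=; rewrite mxE.
exact: measurable_tnth.
Qed.

Lemma borel_funD n (f g : 'rV[R]_n -> R) :
  borel_fun f -> borel_fun g -> borel_fun (fun x => f x + g x).
Proof. exact: measurable_funD. Qed.

Lemma borel_funM n (f g : 'rV[R]_n -> R) :
  borel_fun f -> borel_fun g -> borel_fun (fun x => f x * g x).
Proof. exact: measurable_funM. Qed.

Lemma borel_fun_norm n (f : 'rV[R]_n -> R) :
  borel_fun f -> borel_fun (fun x => `|f x|).
Proof. by move=> mf; apply: (measurableT_comp _ mf). Qed.

Lemma borel_fun_sum n (I : finType) (f : I -> 'rV[R]_n -> R) :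
  (forall i, borel_fun (f i)) -> borel_fun (fun x => \sum_i f i x).
Proof. by move=> mf; apply: measurable_sum => i; exact: mf. Qed.

Lemma borel_le n (f g : 'rV[R]_n -> R) :
  borel_fun f -> borel_fun g -> borel [set x | f x <= g x].
Proof.
move=> mf mg; rewrite /borel.
have := measurable_fun_ler mf mg.
move=> /(_ measurableT [set true]); rewrite setTI; exact.
Qed.

Lemma borel_eq n (f : 'rV[R]_n -> R) c :
  borel_fun f -> borel [set x | f x = c].
Proof.
move=> mf; have -> : [set x | f x = c] = [set x | f x <= c] `&` [set x | c <= f x].
  apply/seteqP; split => x /=; first by move=> ->.
  by move=> [h1 h2]; apply/le_anti; rewrite h1.
by apply: borelI; apply: borel_le => //; exact: borel_fun_cst.
Qed.

Lemma volumeU n (A B : set 'rV[R]_n) : borel A -> borel B -> A `&` B = set0 ->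
  volume (A `|` B) = (volume A + volume B)%E.
Proof.
move=> mA mB AB; rewrite !volumeE preimage_setU measureU//.
by rewrite -preimage_setI AB preimage_set0.
Qed.

Lemma volumeU_le n (A B : set 'rV[R]_n) : borel A -> borel B ->
  (volume (A `|` B) <= volume A + volume B)%E.
Proof. by move=> mA mB; rewrite !volumeE preimage_setU measureU2. Qed.

Lemma tuple_row_cons n (x : R) (t : n.-tuple R) :
  tuple_row [tuple of x :: t] = row_mx (x%:M : 'rV[R]_1) (tuple_row t).
Proof.
apply/rowP => i; rewrite !mxE; case: splitP => j ij.
  by rewrite ord1 mxE eqxx mulr1n (_ : i = ord0)//; apply: val_inj; rewrite /= ij ord1.
by rewrite mxE (_ : i = lift ord0 j) ?tnthS//; apply: val_inj.
Qed.

Definition slice n (A : set 'rV[R]_n.+1) (x : R) : set 'rV[R]_n :=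
  [set y | A (row_mx (x%:M : 'rV[R]_1) y)].

Lemma volume_slice n (A : set 'rV[R]_n.+1) :
  volume A = (\int[lebesgue_measure]_x volume (slice A x))%E.
Proof.
rewrite {1}/volume/= /pushforward /product_measure1.
apply: eq_integral => x _; rewrite /= /volume; congr lebesgue_tuple.
by apply/seteqP; split => t /=; rewrite /xsection/= inE /slice/= -tuple_row_cons.
Qed.

Lemma le_volume n (A B : set 'rV[R]_n) : A `<=` B -> (volume A <= volume B)%E.
Proof.
elim: n A B => [|n IH] A B AB.
  rewrite /volume/= !diracE lee_fin ler_nat.
  have [At|] := boolP ([tuple] \in [set t : 0.-tuple R | A (\row_i tnth t i)]).
    by rewrite (@mem_set _ [set t : 0.-tuple R | _ ] [tuple])//; apply/AB/set_mem.
  by case: (_ \in _).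
rewrite !volume_slice; apply: ge0_le_integralT => x; first exact: volume_ge0.
by apply: IH => y; exact: AB.
Qed.

Lemma volumeD_null n (A N : set 'rV[R]_n) : borel A -> borel N ->
  volume N = 0%E -> volume (A `\` N) = volume A.
Proof.
move=> bA bN N0; apply/le_anti/andP; split; first by apply: le_volume => x [].
apply: (@le_trans _ _ (volume ((A `\` N) `|` N))).
  by apply: le_volume => x Ax; have [xN|xN] := pselect (N x); [right|left].
have bAN : borel (A `\` N) by apply: borelI => //; exact: borelC.
by apply: (le_trans (volumeU_le bAN bN)); rewrite N0 adde0.
Qed.

Let uncons_pre n (A : set 'rV[R]_n.+1) : set (measurableTypeR R * tup n) :=
  (fun p : R * n.-tuple R => tuple_row [tuple of p.1 :: p.2]) @^-1` A.

Let uncons_preE n (A : set 'rV[R]_n.+1) x t :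
  uncons_pre A (x, t) = slice A x (tuple_row t).
Proof. by rewrite /slice/= -tuple_row_cons. Qed.

Let measurable_uncons_pre n (A : set 'rV[R]_n.+1) : borel A ->
  measurable (uncons_pre A).
Proof.
move=> mA; have := @measurable_cons _ _ _ _ fst n snd
  (@measurable_fst _ _ (measurableTypeR R) (tup n))
  (@measurable_snd _ _ (measurableTypeR R) (tup n)).
by move=> /(_ measurableT _ mA); rewrite setTI.
Qed.

Lemma borel_slice n (A : set 'rV[R]_n.+1) x : borel A -> borel (slice A x).
Proof.
move=> /measurable_uncons_pre /(measurable_xsection x); congr measurable.
by apply/seteqP; split => t /=; rewrite /xsection/= inE uncons_preE.
Qed.

Lemma measurable_volume_slice n (A : set 'rV[R]_n.+1) : borel A ->
  measurable_fun [set: R] (fun x => volume (slice A x)).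
Proof.
move=> /measurable_uncons_pre mA.
have := measurable_fun_xsection (tuple_measure n) mA.
congr (measurable_fun _ _); apply/funext => x /=; rewrite volumeE.
congr (tuple_measure n _).
by apply/seteqP; split => t /=; rewrite /xsection/= inE uncons_preE.
Qed.

Lemma measurable_fiber n (A : set 'rV[R]_n.+1) (t : n.-tuple R) : borel A ->
  measurable ([set x | A (row_mx (x%:M : 'rV[R]_1) (tuple_row t))] :
    set (measurableTypeR R)).
Proof.
move=> /measurable_uncons_pre /(measurable_ysection t); congr measurable.
by apply/seteqP; split => x /=; rewrite /ysection/= inE uncons_preE.
Qed.

(** Tonelli's theorem lets the first coordinate be integrated first instead. *)
Lemma volume_fiber n (A : set 'rV[R]_n.+1) : borel A ->
  volume A = (\int[tuple_measure n]_t
    lebesgue_measure [set x | A (row_mx (x%:M : 'rV[R]_1) (tuple_row t))])%E.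
Proof.
move=> bA; have mA := measurable_uncons_pre bA.
have mf : measurable_fun setT (fun p => (\1_(uncons_pre A) p)%:E : \bar R).
  exact/measurable_EFinP/measurable_indic.
transitivity (\int[lebesgue_measure]_x \int[tuple_measure n]_y
    (\1_(uncons_pre A) (x, y))%:E)%E.
  rewrite volume_slice; apply: eq_integral => x _.
  rewrite volumeE -[X in tuple_measure n X]setIT -integral_indic//; last first.
    by apply: borel_slice.
  apply: eq_integral => t _; rewrite !indicE; congr ((nat_of_bool _)%:R%:E).
  by apply/idP/idP => /set_mem h; apply/mem_set; move: h; rewrite uncons_preE.
rewrite (fubini_tonelli _ mf)//; apply: eq_integral => t _.
rewrite -[X in lebesgue_measure X]setIT -integral_indic//; last exact: measurable_fiber.
apply: eq_integral => x _; rewrite !indicE; congr ((nat_of_bool _)%:R%:E).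
by apply/idP/idP => /set_mem h; apply/mem_set; move: h; rewrite uncons_preE.
Qed.

Lemma borel_preimage n m (f : 'rV[R]_n -> 'rV[R]_m) (A : set 'rV[R]_m) :
  (forall j, borel_fun (fun x => f x 0 j)) -> borel A -> borel (f @^-1` A).
Proof.
move=> mf mA.
pose g (t : tup n) : tup m := [tuple f (tuple_row t) 0 j | j < m].
have mg : measurable_fun [set: tup n] g.
  apply/measurable_fun_tnthP => j; have := mf j; congr measurable_fun.
  by apply/funext => t /=; rewrite /g tnth_mktuple.
have := mg measurableT _ mA; rewrite setTI; congr measurable.
apply/seteqP; split => t; rewrite /preimage/= (_ : tuple_row (g t) = f (tuple_row t))//;
  by apply/rowP => j; rewrite mxE /g tnth_mktuple.
Qed.

Lemma borel_affine n (M : 'M[R]_n) b (A : set 'rV[R]_n) :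
  borel A -> borel [set x | A (x *m M + b)].
Proof.
apply: borel_preimage => j; rewrite (_ : (fun _ => _) =
    (fun x : 'rV[R]_n => (\sum_k x 0 k * M k j) + b 0 j)).
  apply: borel_funD; last exact: borel_fun_cst.
  apply: borel_fun_sum => k; apply: borel_funM; last exact: borel_fun_cst.
  exact: borel_fun_coord.
by apply/funext => x; rewrite !mxE.
Qed.

End volume_theory.

(** * Volume under affine maps *)

Section volume_affine.
Context {R : realType}.
Local Notation tup n := (n.-tuple (measurableTypeR R)).

Lemma lebesgue_translate (s : R) (B : set R) :
  measurable (B : set (measurableTypeR R)) ->
  lebesgue_measure [set x | B (x + s)] = lebesgue_measure B.
Proof.
move=> mB; have mf : measurable_fun [set: R] (fun x => (\1_B x)%:E : \bar R).
  by apply/measurable_EFinP/measurable_indic.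
have H : (\int[lebesgue_measure]_x (\1_B (x * 1 + s)%R)%:E = lebesgue_measure B)%E.
  rewrite (@integral_affine R 1 s _ (oner_neq0 R) mf)//.
  rewrite normr1 invr1 mul1e -[RHS](congr1 lebesgue_measure (setIT B)).
  by rewrite -integral_indic.
rewrite -H -[LHS](congr1 lebesgue_measure (setIT [set x | _])) -integral_indic//.
  by apply: eq_integral => x _; rewrite !indicE mulr1.
have mg : measurable_fun [set: measurableTypeR R] (fun x : measurableTypeR R => x + s).
  exact: measurable_funD.
by have := mg measurableT _ mB; rewrite setTI.
Qed.

Definition scales_volume n (M : 'M[R]_n) := forall b (A : set 'rV[R]_n), borel A ->
  volume [set x | A (x *m M + b)] = (`|\det M|^-1%:E * volume A)%E.

Lemma scales_volumeM n (M N : 'M[R]_n) :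
  scales_volume M -> scales_volume N -> scales_volume (M *m N).
Proof.
move=> sM sN b A mA; rewrite det_mulmx normrM invfM mulrC EFinM -muleA muleCA -(sN b)//.
rewrite -(sM 0 [set x | A (x *m N + b)]); last exact: borel_affine.
by congr volume; apply/seteqP; split => x /=; rewrite addr0 mulmxA.
Qed.

(** On the slice at [x], a block upper triangular map is a map [D] with a
    translation, which reduces the dimension; on the first coordinate it is an
    affine substitution. *)
Lemma scales_volume_upper n (a : R) (c : 'rV[R]_n) (D : 'M[R]_n) :
  a != 0 -> scales_volume D ->
  scales_volume (block_mx (a%:M : 'M[R]_1) c 0 D : 'M[R]_n.+1).
Proof.
move=> a0 sD b A mA.
have -> : \det (block_mx (a%:M : 'M[R]_1) c 0 D : 'M[R]_n.+1) = a * \det D.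
  by rewrite (@det_ublock _ 1 n) det_scalar expr1.
rewrite volume_slice.
pose b0 := b 0 0; pose b1 : 'rV[R]_n := rsubmx (b : 'rV[R]_(1 + n)).
have E x (y : 'rV[R]_n) : row_mx (x%:M : 'rV[R]_1) y *m
      block_mx (a%:M : 'M[R]_1) c 0 D + b =
    row_mx ((x * a + b0)%:M : 'rV[R]_1) (y *m D + (x *: c + b1)).
  rewrite (@mul_row_block _ 1 1 n 1 n) mulmx0 addr0 !mul_scalar_mx scale_scalar_mx.
  rewrite -[b in LHS](@hsubmxK _ 1 1 n) add_row_mx; congr row_mx.
    apply/rowP => k; rewrite !ord1 !mxE eqxx !mulr1n; congr (_ + b _ _).
    by apply: val_inj.
  by rewrite -addrA addrCA addrA addrC addrA.
transitivity (\int[lebesgue_measure]_x (`|\det D|^-1%:E * volume (slice A (x * a + b0)))%E)%E.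
  apply: eq_integral => x _; rewrite -(sD (x *: c + b1)); last exact: borel_slice.
  by congr volume; apply/seteqP; split => y; rewrite /slice/= E.
have mg : measurable_fun [set: measurableTypeR R] (fun x : measurableTypeR R => x * a + b0).
  by apply: measurable_funD => //; apply: measurable_funM.
rewrite ge0_integralZl//=.
- rewrite (integral_affine _ a0 (measurable_volume_slice mA)); last by move=> x;
    exact: volume_ge0.
  by rewrite muleA -EFinM normrM invfM mulrC -volume_slice.
- exact: (measurableT_comp (measurable_volume_slice mA) mg).
- by move=> x _; exact: volume_ge0.
Qed.

(** On the fibers along the first coordinate, this shear is a translation. *)
Lemma scales_volume_lower n (c : 'cV[R]_n) : scales_volume (1%:M : 'M[R]_n) ->
  scales_volume (block_mx (1%:M : 'M[R]_1) 0 c 1%:M : 'M[R]_n.+1).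
Proof.
move=> s1 b A mA; pose B := [set x | A (x + b)].
have mB : borel B.
  have := borel_affine 1%:M b mA; congr borel.
  by apply/seteqP; split => x; rewrite /= mulmx1.
have -> : volume A = volume B.
  have := @scales_volume_upper n 1 0 1%:M (oner_neq0 _) s1 b A mA.
  rewrite -(@scalar_mx_block _ 1 n) det1 normr1 invr1 mul1e => <-.
  by congr volume; apply/seteqP; split => x; rewrite /= mulmx1.
rewrite (@det_lblock _ 1 n) !det1 mulr1 normr1 invr1 mul1e.
rewrite [RHS]volume_fiber// volume_fiber; last exact: borel_affine.
apply: eq_integral => t _.
rewrite -(lebesgue_translate ((tuple_row t *m c) 0 0) (measurable_fiber _ mB)).
congr lebesgue_measure.
suff E x : row_mx (x%:M : 'rV[R]_1) (tuple_row t) *m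
      block_mx (1%:M : 'M[R]_1) 0 c 1%:M =
    row_mx ((x + (tuple_row t *m c) 0 0)%:M : 'rV[R]_1) (tuple_row t).
  by apply/seteqP; split => x; rewrite /= E.
rewrite (@mul_row_block _ 1 1 n 1 n) !mulmx1 mulmx0 add0r; congr row_mx.
by apply/rowP => k; rewrite !ord1 !mxE eqxx !mulr1n.
Qed.

(** Gaussian elimination by blocks: a matrix with a nonzero corner is a lower
    shear times a block upper triangular matrix. *)
Lemma scales_volume_unitmx n (M : 'M[R]_n) : M \in unitmx -> scales_volume M.
Proof.
elim: n M => [|n IH] M uM.
  move=> b A mA; rewrite det_mx00 normr1 invr1 mul1e; congr volume.
  by apply/seteqP; split => x; rewrite /= [x *m M + b](_ : _ = x)//; apply/rowP => -[].
have s1 : scales_volume (1%:M : 'M[R]_n) by apply: IH; rewrite unitmx1.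
pose L (c : 'cV[R]_n) := block_mx (1%:M : 'M[R]_1) 0 c 1%:M : 'M[R]_n.+1.
have LM c d : L c *m L d = L (c + d).
  by rewrite /L (@mulmx_block _ 1 n 1 n 1 n) !mulmx1 !mul1mx !mulmx0 !mul0mx !addr0 add0r.
have pivot (N : 'M[R]_n.+1) : N \in unitmx -> N 0 0 != 0 -> scales_volume N.
  move=> uN N0.
  pose a := N 0 0; pose c : 'rV[R]_n := @ursubmx _ 1 n 1 n N.
  pose d : 'cV[R]_n := @dlsubmx _ 1 n 1 n N.
  pose D := @drsubmx _ 1 n 1 n N - a^-1 *: (d *m c).
  have NE : N = L (a^-1 *: d) *m (block_mx (a%:M : 'M[R]_1) c 0 D : 'M[R]_n.+1).
    rewrite /L (@mulmx_block _ 1 n 1 n 1 n) !mul1mx !mul0mx !addr0.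
    rewrite -[LHS](@submxK _ 1 n 1 n). f_equal.
    - by apply/rowP => k; rewrite !ord1 !mxE eqxx mulr1n; congr (N _ _); apply: val_inj.
    - by rewrite mul_mx_scalar scalerA divff// scale1r.
    - by rewrite /D -scalemxAl addrC subrK.
  rewrite NE; apply: scales_volumeM; first exact: scales_volume_lower.
  apply: scales_volume_upper => //; apply: IH.
  move: uN; rewrite NE unitmx_mul => /andP[_].
  by rewrite !unitmxE (@det_ublock _ 1 n) unitrM => /andP[].
pose r : 'rV[R]_n := @ursubmx _ 1 n 1 n M.
(* Adding to the first column the combination of the others with coefficients
   [r], the first row, produces the sum of squares of [r] in the corner. *)
have [M0|M0] := eqVneq (M 0 0) 0; last exact: pivot.
have -> : M = (M *m L r^T) *m L (- r^T).
  by rewrite -mulmxA LM subrr /L -(@scalar_mx_block _ 1 n) mulmx1.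
apply: scales_volumeM; last exact: scales_volume_lower.
apply: pivot.
  by rewrite unitmx_mul uM unitmxE /L (@det_lblock _ 1 n) !det1 mulr1 unitr1.
have rE j : M 0 (lift 0 j) = r 0 j.
  by rewrite !mxE; congr (M _ _); apply: val_inj.
have -> : (M *m L r^T) 0 0 = \sum_j r 0 j ^+ 2.
  rewrite mxE big_ord_recl M0 mul0r add0r; apply: eq_bigr => j _.
  rewrite rE expr2; congr (_ * _).
  rewrite (_ : r 0 j = r^T j 0); last by rewrite [RHS]mxE.
  rewrite -[RHS](@block_mxEdl _ 1 n 1 n (1%:M : 'M[R]_1) 0 r^T 1%:M j 0).
  by congr (L _ _ _); apply: val_inj.
apply/negP; rewrite psumr_eq0 => [/allP r0|j _]; last exact: sqr_ge0.
move: uM; rewrite unitmxE (expand_det_row _ 0) big1 ?unitr0// => j _.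
suff -> : M 0 j = 0 by rewrite mul0r.
have [k ->|->//] := unliftP 0 j.
by rewrite rE; apply/eqP; have := r0 k (mem_index_enum _); rewrite sqrf_eq0.
Qed.

Theorem volume_affine n (M : 'M[R]_n) b (A : set 'rV[R]_n) :
  M \in unitmx -> borel A ->
  volume [set x | A (x *m M + b)] = (`|\det M|^-1%:E * volume A)%E.
Proof. by move=> uM; exact: scales_volume_unitmx. Qed.
End volume_affine.

(** * Rank-one maps and hyperplanes *)

Section simple_volumes.
Context {R : realType}.

(** Factor the block matrix with rows [1, - v] and [u^T, 1] in two ways. *)
Lemma det_add_rank1 n (u v : 'rV[R]_n) :
  \det (1%:M + u^T *m v) = 1 + (v *m u^T) 0 0.
Proof.
pose L : 'M[R]_(1 + n) := block_mx 1%:M 0 u^T 1%:M.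
pose U1 : 'M[R]_(1 + n) := block_mx 1%:M (- v) 0 (1%:M + u^T *m v).
pose U2 : 'M[R]_(1 + n) := block_mx (1%:M + v *m u^T) (- v) 0 1%:M.
have E : L *m U1 = U2 *m L.
  rewrite /L /U1 /U2 !mulmx_block !mul1mx !mul0mx !mulmx0 !mulmx1 !addr0 !add0r.
  by rewrite mulmxN mulNmx [_ + _ *m v]addrC !addKr addrK.
have := congr1 determinant E; rewrite !det_mulmx /L /U1 /U2 !det_lblock !det_ublock.
by rewrite !det1 !mulr1 !mul1r => ->; rewrite [_ + _]mx11_scalar det_scalar1 !mxE.
Qed.

Lemma dotE n (x y : 'rV[R]_n) : dot x y = (x *m y^T) 0 0.
Proof. by rewrite /dot mxE; apply: eq_bigr => i _; rewrite mxE. Qed.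

Lemma dotDl n (x y u : 'rV[R]_n) : dot (x + y) u = dot x u + dot y u.
Proof. by rewrite !dotE mulmxDl mxE. Qed.

Lemma dotZl n a (x u : 'rV[R]_n) : dot (a *: x) u = a * dot x u.
Proof. by rewrite !dotE -scalemxAl mxE. Qed.

Lemma dotBr n (x y z : 'rV[R]_n) : dot x (y - z) = dot x y - dot x z.
Proof. by rewrite !dotE linearB/= mulmxBr !mxE. Qed.

Lemma dotC n (x y : 'rV[R]_n) : dot x y = dot y x.
Proof. by apply: eq_bigr => i _; rewrite mulrC. Qed.

Lemma borel_dot n (u : 'rV[R]_n) : borel_fun (fun x => dot x u).
Proof.
apply: borel_fun_sum => i; apply: borel_funM; last exact: borel_fun_cst.
exact: borel_fun_coord.
Qed.

Lemma dot_delta n (x : 'rV[R]_n) i : dot x (delta_mx 0 i) = x 0 i.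
Proof. by rewrite dotE trmx_delta -colE mxE. Qed.

Lemma mulmx_rank1 n (x w v : 'rV[R]_n) :
  x *m (1%:M + w^T *m v) = x + dot x w *: v.
Proof.
rewrite mulmxDr mulmx1 mulmxA; congr (_ + _).
have -> : x *m w^T = (dot x w)%:M.
  by apply/rowP => k; rewrite ord1 dotE [RHS]mxE eqxx mulr1n.
by rewrite mul_scalar_mx.
Qed.

Lemma row_cons0 n (x : R) (y : 'rV[R]_n) : (row_mx (x%:M : 'rV[R]_1) y : 'rV[R]_n.+1) 0 0 = x.
Proof.
have xE : (x%:M : 'rV[R]_1) 0 0 = x by rewrite mxE eqxx mulr1n.
by rewrite -[RHS]xE -[RHS](@row_mxEl _ 1 1 n _ y); congr (row_mx _ _ _ _); apply: val_inj.
Qed.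

Lemma row_consS n (x : R) (y : 'rV[R]_n) j :
  (row_mx (x%:M : 'rV[R]_1) y : 'rV[R]_n.+1) 0 (lift 0 j) = y 0 j.
Proof.
by rewrite -[RHS](@row_mxEr _ 1 1 n (x%:M : 'rV[R]_1)); congr (row_mx _ _ _ _); apply: val_inj.
Qed.

Lemma volume_coord_hyperplane n (i : 'I_n) (c : R) :
  volume [set x : 'rV[R]_n | x 0 i = c] = 0%E.
Proof.
elim: n i => [[]//|n IH] i; rewrite volume_slice.
have [j ->|->] := unliftP 0 i.
  rewrite (eq_integral (fun=> 0%E)) ?integral0// => x _.
  rewrite -(IH j); congr volume; apply/seteqP; split => y; rewrite /slice/= row_consS//.
rewrite (_ : (fun x => _) = (fun x => volume (slice [set x0 : 'rV[R]_n.+1 | x0 0 0 = c] x)) \_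
    [set c]); last first.
  apply/funext => x; rewrite patchE; case: ifPn => // /negP xc.
  rewrite volumeE (_ : _ @^-1` _ = set0) ?measure0//.
  apply/seteqP; split => t //=; rewrite /slice/= row_cons0 => xc'.
  by apply: xc; rewrite inE.
by rewrite -integral_mkcond integral_set1.
Qed.

(** A rank-one change of variables turns [dot x u] into a coordinate. *)
Lemma volume_hyperplane n (u : 'rV[R]_n) (c : R) : u != 0 ->
  volume [set x | dot x u = c] = 0%E.
Proof.
move=> u0; have [i ui] : exists i, u 0 i != 0.
  apply/existsP; apply: contraR u0; rewrite negb_exists => /forallP u0.
  by apply/eqP/rowP => i; rewrite mxE; apply/eqP; have := u0 i; rewrite negbK.
pose M := 1%:M + (u - delta_mx 0 i)^T *m delta_mx 0 i.
have dM : \det M = u 0 i.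
  by rewrite det_add_rank1 -rowE !mxE !eqxx mulr1n addrCA subrr addr0.
have uM : M \in unitmx by rewrite unitmxE dM unitfE.
have ME x : (x *m M) 0 i = dot x u.
  rewrite /M mulmx_rank1 dotBr dot_delta !mxE !eqxx mulr1.
  by rewrite addrC subrK.
have mH : borel [set x : 'rV[R]_n | x 0 i = c].
  by apply: borel_eq; exact: borel_fun_coord.
have := volume_affine 0 uM mH; rewrite volume_coord_hyperplane mule0 => <-.
by congr volume; apply/seteqP; split => x; rewrite /= addr0 ME.
Qed.

Lemma borel_hyperplane n (u : 'rV[R]_n) c : borel [set x | dot x u = c].
Proof. by apply: borel_eq; exact: borel_dot. Qed.

Lemma integral_pow n :
  (\int[lebesgue_measure]_(x in `[0%R, 1%R]) ((x : R) ^+ n)%:E = (n.+1%:R^-1 : R)%:E)%E.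
Proof.
have dF (x : R) : is_derive x 1 (fun x : R => n.+1%:R^-1 * x ^+ n.+1) (x ^+ n).
  have -> : (fun x : R => n.+1%:R^-1 * x ^+ n.+1) = (n.+1%:R^-1 \*: (@id R) ^+ n.+1).
    by apply/funext => y; rewrite /= exprfctE.
  have -> : x ^+ n = n.+1%:R^-1 *: (n.+1%:R * x ^+ n)%:A :> R.
    by rewrite /GRing.scale /= mulr1 mulKf.
  exact: is_deriveZ.
have dF' (x : R) : derivable (fun x : R => n.+1%:R^-1 * x ^+ n.+1) x 1.
  by case: (dF x).
have cF : continuous (fun x : R => n.+1%:R^-1 * x ^+ n.+1).
  by move=> x; apply/differentiable_continuous/derivable1_diffP.
rewrite (@continuous_FTC2 _ _ (fun x => n.+1%:R^-1 * x ^+ n.+1)) ?ltr01//.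
- by rewrite expr1n expr0n/= mulr0 sube0 mulr1.
- by apply: continuous_subspaceT => x; exact: exprn_continuous.
- split => [x _| |]; first exact: dF'.
  + by apply: cvg_at_right_filter; exact: cF.
  + by apply: cvg_at_left_filter; exact: cF.
- by move=> x _; rewrite derive1E; case: (dF x).
Qed.
End simple_volumes.

(** * Signed permutations, dilations and cones *)

Section body_volumes.
Context {R : realType}.

Lemma volume_rank1 n (w v b : 'rV[R]_n) (A : set 'rV[R]_n) :
  1 + dot v w != 0 -> borel A ->
  volume [set x | A (x + dot x w *: v + b)] = (`|1 + dot v w|^-1%:E * volume A)%E.
Proof.
move=> d0 mA; have dE : \det (1%:M + w^T *m v) = 1 + dot v w.
  by rewrite det_add_rank1 dotE.
rewrite -dE -(volume_affine b) ?unitmxE ?dE ?unitfE//.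
by congr volume; apply/seteqP; split => x; rewrite /= mulmx_rank1.
Qed.

Lemma volume_diag n (d : 'rV[R]_n) b (A : set 'rV[R]_n) :
  (forall i, d 0 i != 0) -> borel A ->
  volume [set x | A (\row_i (x 0 i * d 0 i) + b)] =
    (`|\prod_i d 0 i|^-1%:E * volume A)%E.
Proof.
move=> d0 mA; rewrite -det_diag -(volume_affine b)//; last first.
  by rewrite unitmxE det_diag unitfE; apply/prodf_neq0.
congr volume; apply/seteqP; split => x; rewrite /= (_ : \row_i _ = x *m diag_mx d)//;
  by apply/rowP => i; rewrite mul_mx_diag !mxE.
Qed.

Lemma volume_perm n (s : 'S_n) (A : set 'rV[R]_n) : borel A ->
  volume [set x | A (\row_i x 0 (s i))] = volume A.
Proof.
move=> mA; have uM : perm_mx s^-1 \in @unitmx R n by exact: unitmx_perm.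
transitivity (volume [set x | A (x *m perm_mx s^-1 + 0)]).
  congr volume; apply/seteqP; split => x;
      rewrite /= addr0 -col_permE (_ : col_perm _ x = \row_i x 0 (s i))//;
  by apply/rowP => i; rewrite !mxE.
by rewrite volume_affine// det_perm normrX normrN1 expr1n invr1 mul1e.
Qed.

Lemma volume_signed_swap n (i k : 'I_n) (s : R) (A : set 'rV[R]_n) :
  `|s| = 1 -> borel A ->
  volume [set x | A (\row_j (s * x 0 (tperm k i j)))] = volume A.
Proof.
move=> s1 bA; have s0 : s != 0 by rewrite -normr_eq0 s1 oner_eq0.
rewrite -(volume_perm (tperm k i) bA).
pose d : 'rV[R]_n := \row__ s.
have d0 j : d 0 j != 0 by rewrite mxE.
have bB : borel [set x : 'rV[R]_n | A (\row_j x 0 (tperm k i j))].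
  apply: (@borel_preimage _ n n (fun x => \row_j x 0 (tperm k i j)) A) => // j.
  rewrite (_ : (fun _ => _) = (fun x : 'rV[R]_n => x 0 (tperm k i j))).
    exact: borel_fun_coord.
  by apply/funext => x; rewrite mxE.
have := volume_diag 0 d0 bB.
rewrite (eq_bigr (fun=> s)) => [|j _]; last by rewrite mxE.
rewrite prodr_const normrX s1 expr1n invr1 mul1e => <-; congr volume.
have E x : \row_j ((\row_l (x 0 l * d 0 l) + 0) 0 (tperm k i j)) =
    \row_j (s * x 0 (tperm k i j)) :> 'rV[R]_n.
  by apply/rowP => j; rewrite addr0 !mxE mulrC.
by apply/seteqP; split => x /=; rewrite E.
Qed.

Lemma volume_dilate n (r : R) b (A : set 'rV[R]_n) : r != 0 -> borel A ->
  volume [set x | A (r *: x + b)] = ((`|r| ^+ n)^-1%:E * volume A)%E.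
Proof.
move=> r0 mA; transitivity (volume [set x | A (\row_i (x 0 i * (\row_(k < n) r) 0 i) + b)]).
  congr volume; apply/seteqP; split => x; rewrite /= (_ : \row_i _ = r *: x)//;
  by apply/rowP => i; rewrite !mxE mulrC.
rewrite volume_diag//; last by move=> i; rewrite mxE.
by rewrite (eq_bigr (fun=> r)) ?prodr_const ?card_ord ?normrX// => i _; rewrite mxE.
Qed.

Lemma volume_set0 n : volume (set0 : set 'rV[R]_n) = 0%E.
Proof. by rewrite volumeE preimage_set0 measure0. Qed.

(** The slice of a cone at height [x] is its base dilated by [x], whose volume is
    integrated over [0, 1]. *)
Lemma volume_cone n (A : set 'rV[R]_n) (B : set 'rV[R]_n.+1) :
  borel A -> borel B ->
  (forall x y, 0 < x <= 1 -> slice B x y <-> A (x^-1 *: y)) ->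
  (forall x y, slice B x y -> 0 <= x <= 1) ->
  volume B = (n.+1%:R^-1%:E * volume A)%E.
Proof.
move=> mA mB BA B01; rewrite volume_slice.
transitivity (\int[lebesgue_measure]_(x in `]0%R, 1%R]) volume (slice B x))%E.
  rewrite integral_itv_obnd_cbnd; last first.
    by apply: measurable_funTS; exact: measurable_volume_slice.
  rewrite integral_mkcond [RHS]integral_mkcond; congr (integral _ _ _).
  apply/funext => x; rewrite !patchE in_setT; case: ifPn => // xn.
  rewrite -[RHS](volume_set0 n); congr volume; apply/seteqP; split => y //= /B01.
  by move=> x01; move/negP: xn; apply; rewrite inE/= in_itv.
transitivity (\int[lebesgue_measure]_(x in `]0%R, 1%R]) ((x ^+ n)%:E * volume A))%E.
  apply: eq_integral => x; rewrite inE/= in_itv/= => x01.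
  have /andP[x0 x1] := x01; rewrite (_ : slice B x = [set y | A (x^-1 *: y + 0)]).
    rewrite volume_dilate// ?invr_eq0 ?gt_eqF// normrV ?unitfE ?gt_eqF//.
    by rewrite gtr0_norm// exprVn invrK.
  by apply/seteqP; split => y; rewrite /= addr0; have [] := BA x y x01.
rewrite integral_itv_obnd_cbnd; last first.
  apply: emeasurable_funM => //; apply/measurable_EFinP.
  by apply: measurable_funTS; exact: exprn_measurable.
rewrite ge0_integralZr//=; first by rewrite integral_pow.
- apply/measurable_EFinP; apply: measurable_funTS; exact: exprn_measurable.
- by move=> x; rewrite in_itv/= => /andP[x0 _]; rewrite lee_fin exprn_ge0.
- exact: volume_ge0.
Qed.
End body_volumes.

(** * Volumes of the polytopes and of the cones over their facets *)

Section polytope_volumes.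
Context {R : realType}.

Lemma cubeP n (x : 'rV[R]_n) : cube R n x <-> forall i, `|x 0 i| <= 1.
Proof.
split => [/bigmax_leP[_ H] i|H]; first exact: H.
by apply/bigmax_leP; split => // i _; exact: H.
Qed.

Lemma borel_cube n : borel (cube R n).
Proof.
rewrite (_ : cube R n = [set x | forall i, `|x 0 i| <= 1]).
  apply: borel_forall => i; apply: borel_le; last exact: borel_fun_cst.
  by apply: borel_fun_norm; exact: borel_fun_coord.
by apply/seteqP; split => x /cubeP.
Qed.

Definition l1norm n (x : 'rV[R]_n) : R := \sum_(i < n) `|x 0 i|.

Lemma borel_l1norm n : borel_fun (@l1norm n).
Proof.
by apply: borel_fun_sum => i; apply: borel_fun_norm; exact: borel_fun_coord.
Qed.

Lemma borel_cross_polytope n : borel (cross_polytope R n).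
Proof. by apply: borel_le; [exact: borel_l1norm|exact: borel_fun_cst]. Qed.

Lemma volume_rV0 (A : set 'rV[R]_0) : A 0 -> volume A = 1%E.
Proof.
move=> A0; rewrite /volume/= diracE (_ : _ \in _ = true)//.
by apply/mem_set => /=; rewrite (_ : \row_i _ = 0)//; apply/rowP => -[].
Qed.

Lemma forall_ordS n (P : 'I_n.+1 -> Prop) :
  (forall i, P i) <-> P 0 /\ forall j, P (lift 0 j).
Proof.
split=> [H|[H0 HS] i]; first by split.
by have [j ->|->] := unliftP 0 i.
Qed.

Lemma l1norm_cons n (x : R) (y : 'rV[R]_n) :
  l1norm (row_mx (x%:M : 'rV[R]_1) y : 'rV[R]_n.+1) = `|x| + l1norm y.
Proof.
rewrite /l1norm big_ord_recl row_cons0; congr (_ + _).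
by apply: eq_bigr => i _; rewrite row_consS.
Qed.

Lemma l1norm_ge0 n (x : 'rV[R]_n) : 0 <= l1norm x.
Proof. exact: sumr_ge0. Qed.

Lemma l1normZ n a (x : 'rV[R]_n) : l1norm (a *: x) = `|a| * l1norm x.
Proof. by rewrite /l1norm mulr_sumr; apply: eq_bigr => i _; rewrite mxE normrM. Qed.

Lemma volume_cube n : volume (cube R n) = (2 ^+ n)%:E.
Proof.
elim: n => [|n IH]; first by rewrite volume_rV0//; apply/cubeP => -[].
rewrite volume_slice.
have slE x : slice (cube R n.+1) x = if `|x| <= 1 then cube R n else set0.
  apply/seteqP; split => y; rewrite /slice/=.
    move=> /cubeP/forall_ordS[]; rewrite row_cons0 => -> H.
    by apply/cubeP => i; have := H i; rewrite row_consS.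
  case: ifP => // x1 /cubeP Hy; apply/cubeP/forall_ordS; rewrite row_cons0; split => // j.
  by rewrite row_consS.
rewrite (_ : (fun x => _) = cst (2 ^+ n)%:E \_ `[-1, 1]%classic); last first.
  apply/funext => x; rewrite patchE slE -IH mem_setE in_itv/= -ler_norml.
  by case: ifP => // _; rewrite volume_set0.
rewrite -integral_mkcond integral_cst//= lebesgue_measure_itv/= lte_fin.
rewrite ifT ?(lt_trans _ ltr01)// ?oppr_lt0//.
by rewrite -EFinB -EFinM exprSr opprK.
Qed.

(** A pyramid over a facet of the cube with apex at the center. *)
Definition pyramid n (i : 'I_n) (s : R) : set 'rV[R]_n :=
  [set z | 0 <= s * z 0 i <= 1 /\ forall j, `|z 0 j| <= s * z 0 i].

Lemma borel_itv01 n (f : 'rV[R]_n -> R) : borel_fun f -> borel [set z | 0 <= f z <= 1].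
Proof.
move=> mf; rewrite (_ : [set z | _] = [set z | 0 <= f z] `&` [set z | f z <= 1]).
  by apply: borelI; apply: borel_le => //; exact: borel_fun_cst.
by apply/seteqP; split => z /= /andP.
Qed.

Lemma borel_pyramid n (i : 'I_n) s : borel (pyramid i s).
Proof.
have mf : borel_fun (fun z : 'rV[R]_n => s * z 0 i).
  by apply: borel_funM; [exact: borel_fun_cst|exact: borel_fun_coord].
apply: borelI; first exact: borel_itv01.
by apply: borel_forall => j; apply: borel_le => //; apply: borel_fun_norm; exact: borel_fun_coord.
Qed.

Lemma volume_pyramid0 n : volume (pyramid (0 : 'I_n.+1) 1) = (2 ^+ n / n.+1%:R)%:E.
Proof.
rewrite (@volume_cone _ _ (cube R n)); first last.
- by move=> x y [] + _; rewrite /= row_cons0 mul1r.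
- move=> x y /andP[x0 x1]; rewrite /slice /pyramid/= row_cons0 mul1r (ltW x0) x1.
  rewrite cubeP; split.
    move=> [_ H] i; have := H (lift 0 i); rewrite row_consS mxE normrM normfV (gtr0_norm x0).
    by rewrite ler_pdivrMl// mulr1.
  move=> H; split => //; apply/forall_ordS; rewrite row_cons0; split; first by rewrite gtr0_norm.
  move=> j; have := H j.
  by rewrite row_consS mxE normrM normfV (gtr0_norm x0) ler_pdivrMl// mulr1.
- exact: borel_pyramid.
- exact: borel_cube.
by rewrite volume_cube -EFinM mulrC.
Qed.

Lemma volume_pyramid n (i : 'I_n) s : `|s| = 1 ->
  volume (pyramid i s) = (2 ^+ n.-1 / n%:R)%:E.
Proof.
case: n i => [[]//|n] i s1; rewrite -[RHS]volume_pyramid0.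
rewrite -(volume_signed_swap i 0 s1 (@borel_pyramid n.+1 0 1)); congr volume.
apply/seteqP; split => x; rewrite /pyramid/= !mxE tpermL mul1r => -[-> H]; split=> // j.
  by rewrite mxE normrM s1 mul1r.
by have := H (tperm 0 i j); rewrite mxE normrM s1 mul1r tpermK.
Qed.

Definition corner_simplex n : set 'rV[R]_n :=
  [set z | (forall i, 0 <= z 0 i) /\ \sum_i z 0 i <= 1].

Lemma borel_corner_simplex n : borel (@corner_simplex n).
Proof.
apply: borelI.
  apply: borel_forall => j.
  by apply: borel_le; [exact: borel_fun_cst|exact: borel_fun_coord].
apply: borel_le; last exact: borel_fun_cst.
by apply: borel_fun_sum => j; exact: borel_fun_coord.
Qed.

(** The half-ball {0 <= s z_0, |z|_1 <= 1} and the simplex are both cones, seen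
    from the vertex (s, 0, .., 0). *)
Lemma volume_flip_cone n (s : R) (A : set 'rV[R]_n) (B C : set 'rV[R]_n.+1) :
  s ^+ 2 = 1 -> borel A -> borel B ->
  (forall x y, 0 < x <= 1 -> slice B x y <-> A (x^-1 *: y)) ->
  (forall x y, slice B x y -> 0 <= x <= 1) ->
  (forall x y, slice C x y <-> slice B (1 - s * x) y) ->
  volume C = (n.+1%:R^-1%:E * volume A)%E.
Proof.
move=> s2 mA mB BA B01 CB; rewrite -(volume_cone mA mB BA B01).
have s0 : - s != 0 by rewrite oppr_eq0 -sqrf_eq0 s2 oner_eq0.
have ns : `|- s| = 1.
  by rewrite normrN; apply/eqP; rewrite -(@eqrXn2 _ 2)// -normrX s2 normr1 expr1n.
transitivity (\int[lebesgue_measure]_x volume (slice B (x * - s + 1)))%E.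
  rewrite volume_slice; apply: eq_integral => x _; congr volume.
  by apply/seteqP; split => y; rewrite (_ : x * - s + 1 = 1 - s * x) ?CB// mulrN mulrC addrC.
rewrite (integral_affine _ s0 (measurable_volume_slice mB)); last by move=> x; exact: volume_ge0.
by rewrite ns invr1 mul1e -volume_slice.
Qed.

Lemma volume_corner_simplex n : volume (@corner_simplex n) = (n`!%:R^-1)%:E.
Proof.
elim: n => [|n IH].
  by rewrite volume_rV0 ?fact0 ?invr1//; split; [case|rewrite big_ord0].
pose B := [set z : 'rV[R]_n.+1 | 0 <= z 0 0 <= 1 /\
  (forall j, 0 <= z 0 (lift 0 j)) /\ \sum_(j < n) z 0 (lift 0 j) <= z 0 0].
have sumE x (y : 'rV[R]_n) :
    \sum_(j < n) (row_mx (x%:M : 'rV[R]_1) y : 'rV[R]_n.+1) 0 (lift 0 j) = \sum_j y 0 j.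
  by apply: eq_bigr => j _; rewrite row_consS.
have slB x y : slice B x y <-> [/\ 0 <= x <= 1, forall j, 0 <= y 0 j & \sum_j y 0 j <= x].
  rewrite /slice /B/= row_cons0 sumE; split => [[? [H ?]]|[? H ?]].
    by split => // j; have := H j; rewrite row_consS.
  by split => //; split => // j; rewrite row_consS.
rewrite (@volume_flip_cone _ 1 (@corner_simplex n) B) ?expr1n//.
- by rewrite IH -EFinM factS natrM invfM.
- exact: borel_corner_simplex.
- apply: borelI; first by apply: borel_itv01; exact: borel_fun_coord.
  apply: borelI; first by apply: borel_forall => j; apply: borel_le;
      [exact: borel_fun_cst|exact: borel_fun_coord].
  apply: borel_le; last exact: borel_fun_coord.
  by apply: borel_fun_sum => j; exact: borel_fun_coord.
- move=> x y /andP[x0 x1]; rewrite slB (ltW x0) x1 /corner_simplex/=.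
  have xi0 : 0 < x^-1 by rewrite invr_gt0.
  have -> : \sum_i (x^-1 *: y) 0 i = x^-1 * \sum_i y 0 i.
    by rewrite mulr_sumr; apply: eq_bigr => i _; rewrite mxE.
  rewrite ler_pdivrMl// mulr1; split => [[_ H ?]|[H ?]]; split => // i.
    by rewrite mxE mulr_ge0// ltW.
  by have := H i; rewrite mxE pmulr_rge0.
- by move=> x y /slB[].
- move=> x y; rewrite slB /slice /corner_simplex/= mul1r big_ord_recl row_cons0 sumE
    forall_ordS row_cons0; split.
    move=> [[x0 H] xs]; have y0 : 0 <= \sum_j y 0 j.
      by apply: sumr_ge0 => j _; have := H j; rewrite row_consS.
    split; [by lra| |by lra].
    by move=> j; have := H j; rewrite row_consS.
  by move=> [/andP[? ?] H ?]; split; [split; [lra|move=> j; rewrite row_consS]|lra].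
Qed.

Definition half_cross_polytope n (s : R) : set 'rV[R]_n.+1 :=
  [set z : 'rV[R]_n.+1 | 0 <= s * z 0 0 /\ l1norm z <= 1].

(** The cone from 0 over a cross-polytope at height 1: the second condition says
    that the other coordinates have norm at most [z 0 0]. *)
Definition l1_cone n : set 'rV[R]_n.+1 :=
  [set z : 'rV[R]_n.+1 | 0 <= z 0 0 <= 1 /\ l1norm z <= 2 * z 0 0].

Lemma borel_l1_cone n : borel (@l1_cone n).
Proof.
apply: borelI; first by apply: borel_itv01; exact: borel_fun_coord.
apply: borel_le; first exact: borel_l1norm.
by apply: borel_funM; [exact: borel_fun_cst|exact: borel_fun_coord].
Qed.

Lemma slice_l1_cone n x (y : 'rV[R]_n) :
  slice (@l1_cone n) x y <-> 0 <= x <= 1 /\ l1norm y <= x.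
Proof.
rewrite /slice/= /l1_cone/= row_cons0 l1norm_cons.
by split => -[x01]; have /andP[x0 x1] := x01; rewrite (ger0_norm x0) => ?; split => //; lra.
Qed.

Lemma l1_cone_base n x (y : 'rV[R]_n) : 0 < x <= 1 ->
  slice (@l1_cone n) x y <-> cross_polytope R n (x^-1 *: y).
Proof.
move=> /andP[x0 x1]; rewrite slice_l1_cone (ltW x0) x1 /cross_polytope/=.
rewrite -[\sum_i _]/(l1norm _) l1normZ normrV ?unitfE ?gt_eqF// gtr0_norm//.
by rewrite ler_pdivrMl// mulr1; split => [[]|].
Qed.

Lemma volume_l1_cone n :
  volume (@l1_cone n) = (n.+1%:R^-1%:E * volume (cross_polytope R n))%E.
Proof.
apply: volume_cone; [exact: borel_cross_polytope|exact: borel_l1_cone| |].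
  by move=> x y; exact: l1_cone_base.
by move=> x y /slice_l1_cone[].
Qed.

Lemma volume_half_cross_polytope n s : s ^+ 2 = 1 ->
  volume (@half_cross_polytope n s) = (n.+1%:R^-1%:E * volume (cross_polytope R n))%E.
Proof.
move=> s2; apply: (@volume_flip_cone _ s _ (@l1_cone n)) => //.
- exact: borel_cross_polytope.
- exact: borel_l1_cone.
- by move=> x y; exact: l1_cone_base.
- by move=> x y /slice_l1_cone[].
move=> x y; rewrite slice_l1_cone /slice /half_cross_polytope/= row_cons0 l1norm_cons.
have s1 : `|s| = 1.
  by apply/eqP; rewrite -(@eqrXn2 _ 2)// -normrX s2 normr1 expr1n.
have y0 := l1norm_ge0 y.
have -> : `|x| = `|s * x| by rewrite normrM s1 mul1r.
split => -[sx]; first by rewrite ger0_norm// => ?; split; lra.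
by move=> ?; rewrite ger0_norm; [split; lra|lra].
Qed.

Lemma volume_cross_polytope n : volume (cross_polytope R n) = (2 ^+ n / n`!%:R)%:E.
Proof.
elim: n => [|n IH].
  by rewrite volume_rV0 ?fact0 ?invr1 ?expr0 ?mulr1// /cross_polytope/= big_ord0.
have mH s : borel (@half_cross_polytope n s).
  apply: borelI; apply: borel_le; try exact: borel_fun_cst.
    by apply: borel_funM; [exact: borel_fun_cst|exact: borel_fun_coord].
  exact: borel_l1norm.
have hv s : s ^+ 2 = 1 -> volume (@half_cross_polytope n s) = (2 ^+ n / n.+1`!%:R)%:E.
  move=> s2; rewrite volume_half_cross_polytope// IH -EFinM; congr EFin.
  by rewrite factS natrM invfM mulrCA.
pose N := [set z : 'rV[R]_n.+1 | z 0 0 = 0].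
have mN : borel N by apply: borel_eq; exact: borel_fun_coord.
rewrite (_ : cross_polytope R n.+1 =
    half_cross_polytope 1 `|` (half_cross_polytope (-1) `\` N)); last first.
  apply/seteqP; split => z; rewrite /half_cross_polytope/= /N/= mul1r mulN1r oppr_ge0.
    move=> z1; have [z0|z0] := leP 0 (z 0 0); first by left.
    by right; split; [split; [exact: ltW|]|move=> z00; rewrite z00 ltxx in z0].
  by move=> [[]//|[[]]].
have mHN : borel (half_cross_polytope (-1) `\` N) by apply: borelI => //; exact: borelC.
rewrite volumeU//; last first.
  apply/seteqP; split => z //=; rewrite /half_cross_polytope/= /N/= mul1r mulN1r oppr_ge0.
  by move=> [[z0 _] [[z0' _]]]; apply; apply/le_anti; rewrite z0 z0'.
rewrite volumeD_null ?volume_coord_hyperplane//.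
rewrite !hv ?expr1n ?sqrrN ?expr1n// -EFinD; congr EFin.
by rewrite exprSr; field; rewrite pnatr_eq0 -lt0n fact_gt0.
Qed.
End polytope_volumes.

(** * Convex hulls and pyramids over facets *)

Section convex_hulls.
Context {R : realType}.

Lemma convex_setP n (A : set 'rV[R]_n) : @convex_set R 'rV[R]_n A <->
  forall x y t, 0 <= t <= 1 -> A x -> A y -> A (t *: x + (1 - t) *: y).
Proof.
split => [cA x y t /andP[t0 t1] Ax Ay|H x y l xA yA].
  by have /set_mem := cA x y (Itv01 t0 t1) (mem_set Ax) (mem_set Ay).
apply: mem_set; have := H x y l%:num _ (set_mem xA) (set_mem yA).
by apply; rewrite ge0 le1.
Qed.

Lemma convex_hull_join n (K : set 'rV[R]_n) p k t :
  0 <= t <= 1 -> K k -> convex_hull (K `|` [set p]) (t *: k + (1 - t) *: p).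
Proof.
move=> t01 Kk C [/convex_setP cC KC].
by apply: cC => //; apply: KC; [left|right].
Qed.

Lemma convex_hull_joinE n (K : set 'rV[R]_n) p z :
  @convex_set R 'rV[R]_n K -> K !=set0 -> convex_hull (K `|` [set p]) z ->
  exists t k, [/\ 0 <= t <= 1, K k & z = t *: k + (1 - t) *: p].
Proof.
move=> /convex_setP cK [k0 Kk0].
pose J := [set z | exists t k, [/\ 0 <= t <= 1, K k & z = t *: k + (1 - t) *: p]].
apply: (_ : convex_hull _ `<=` J); apply: smallest_sub; last first.
  move=> x [Kx|->].
    by exists 1, x; rewrite subrr scale0r addr0 scale1r ler01 lexx.
  by exists 0, k0; rewrite subr0 scale0r add0r scale1r ler01 lexx.
apply/convex_setP => _ _ s /andP[s0 s1] [t [x [/andP[t0 t1] Kx ->]]] [u [y [/andP[u0 u1] Ky ->]]].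
have sc0 : 0 <= 1 - s by rewrite subr_ge0.
have st0 : 0 <= s * t by exact: mulr_ge0.
have su0 : 0 <= (1 - s) * u by exact: mulr_ge0.
have [c0|c0] := eqVneq (s * t + (1 - s) * u) 0.
  exists 0, k0; split; rewrite ?ler01 ?lexx//.
  have h1 : s * t = 0 by lra.
  have h2 : (1 - s) * u = 0 by lra.
  rewrite !scalerDr !scalerA h1 h2 !scale0r !add0r -scalerDl subr0; congr (_ *: _); lra.
have cp : 0 < s * t + (1 - s) * u by rewrite lt_neqAle eq_sym c0 addr_ge0.
exists (s * t + (1 - s) * u),
  ((s * t / (s * t + (1 - s) * u)) *: x + (1 - (s * t / (s * t + (1 - s) * u))) *: y).
split.
- rewrite (ltW cp)/=; have : s * (1 - t) >= 0 by rewrite mulr_ge0// subr_ge0.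
  have : (1 - s) * (1 - u) >= 0 by rewrite mulr_ge0// subr_ge0.
  lra.
- apply: cK => //; apply/andP; split; first by rewrite divr_ge0// ltW.
  by rewrite ler_pdivrMr// mul1r lerDl.
apply/rowP => i; rewrite !mxE; field; exact: c0.
Qed.
End convex_hulls.

Section facet_pyramids.
Context {R : realType}.
Variables (n : nat) (K D : set 'rV[R]_n) (phi : 'rV[R]_n).
(** [phi] cuts out a facet of [K], and [D] is the cone over it from 0. *)
Hypotheses (bK : borel K) (bD : borel D).
Hypothesis Kphi : forall z, K z -> dot z phi <= 1.
Hypothesis Dphi : forall z, D z -> 0 <= dot z phi <= 1.

Variable p : 'rV[R]_n.
Hypothesis p1 : 1 < dot p phi.

(** The affine map [y |-> y + (1 - <y, phi>) p] fixes the facet and sends 0 to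
    [p]: it maps [D] onto the pyramid [P] over the facet with apex [p]. *)
Let mu z := (dot z phi - 1) / (dot p phi - 1).
Let P := [set z | D (z - mu z *: p)].

Let r0 : dot p phi - 1 != 0.
Proof. by rewrite gt_eqF// subr_gt0. Qed.

Let PE : P = [set z | D (z + dot z phi *: (- (dot p phi - 1)^-1 *: p) + (dot p phi - 1)^-1 *: p)].
Proof.
apply/seteqP; split => z; rewrite /P/= (_ : z - _ = z + dot z phi *: (- (dot p phi - 1)^-1 *: p) +
   (dot p phi - 1)^-1 *: p)//; by rewrite /mu scalerA -addrA -scalerDl -scaleNr;
       congr (_ + _ *: _); field.
Qed.

Let detE : 1 + dot (- (dot p phi - 1)^-1 *: p) phi = - (dot p phi - 1)^-1.
Proof. by rewrite dotZl; field. Qed.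

Let bP : borel P.
Proof.
rewrite PE; have := borel_affine (1%:M + phi^T *m (- (dot p phi - 1)^-1 *: p)) ((dot p phi -
    1)^-1 *: p) bD.
by congr borel; apply/seteqP; split => z; rewrite /= mulmx_rank1.
Qed.

Let volP : volume P = ((dot p phi - 1)%:E * volume D)%E.
Proof.
rewrite PE volume_rank1// detE ?oppr_eq0 ?invr_eq0//.
by rewrite normrN normfV invrK gtr0_norm// subr_gt0.
Qed.

Let mu_ge0 z : P z -> 0 <= mu z <= 1.
Proof.
move=> /Dphi; rewrite -scaleNr dotDl dotZl (_ : _ + _ = 1 - mu z); last by rewrite /mu; field.
by move=> /andP[h1 h2]; apply/andP; split; lra.
Qed.

(** The pyramid lies in the hull, and meets [K] in the hyperplane of the facet
    only, which is a null set. *)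
Lemma volume_hull_ge : (forall y, D y -> exists2 k, K k & y = dot y phi *: k) ->
  (volume K + (dot p phi - 1)%:E * volume D <= volume (convex_hull (K `|` [set p])))%E.
Proof.
move=> DK; rewrite -volP; pose N := [set z | dot z phi = 1].
have phi0 : phi != 0.
  apply: contraTneq p1 => ->; rewrite /dot big1 -?leNgt ?ler01// => i _.
  by rewrite mxE mulr0.
have bN : borel N by exact: borel_hyperplane.
have bPN : borel (P `\` N) by apply: borelI => //; exact: borelC.
rewrite -(volumeD_null bP bN (volume_hyperplane _ phi0)).
rewrite -volumeU//; last first.
  apply/seteqP; split => z //= [/Kphi z1 [/mu_ge0/andP[m0 _] zN]]; apply: zN.
  apply/le_anti; rewrite z1/=.
  by move: m0; rewrite /mu pmulr_lge0 ?invr_gt0 ?subr_gt0// subr_ge0.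
apply: le_volume => z [Kz|[Pz _]].
  by have := convex_hull_join (p := p) (t := 1) _ Kz; rewrite subrr scale0r addr0 scale1r;
      apply; rewrite ler01 lexx.
have [k Kk zE] := DK _ Pz.
have yphi : dot (z - mu z *: p) phi = 1 - mu z.
  by rewrite -scaleNr dotDl dotZl /mu; field.
have -> : z = (1 - mu z) *: k + (1 - (1 - mu z)) *: p.
  by rewrite -{1}yphi -zE opprB addrC subrKC; apply/esym/subrKC.
apply: convex_hull_join Kk; have /andP[? ?] := mu_ge0 Pz.
by apply/andP; split; lra.
Qed.

(** Seen from [p], only the facet [phi] is visible: [p] satisfies the other
    constraints, which define [K']. *)
Variable K' : set 'rV[R]_n.
Hypotheses (cK' : @convex_set R 'rV[R]_n K') (K'p : K' p).
Hypothesis KE : forall z, K z <-> K' z /\ dot z phi <= 1.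
Hypothesis D0 : D 0.
Hypothesis K'D : forall q t, K' q -> dot q phi = 1 -> 0 <= t <= 1 -> D (t *: q).

(** A point [z] of the hull beyond the facet is on the segment from [p] to a point
    [q] of the hyperplane of the facet. This [q] is on the line through [p] and
    some [k] in [K], between them, so it satisfies the other constraints and is on
    the facet. *)
Lemma volume_hull_le : K !=set0 ->
  (volume (convex_hull (K `|` [set p])) <= volume K + (dot p phi - 1)%:E * volume D)%E.
Proof.
move=> K0; rewrite -volP; apply: (@le_trans _ _ (volume (K `|` P))); last exact: volumeU_le.
have /convex_setP cK'P := cK'.
have cK : @convex_set R 'rV[R]_n K.
  apply/convex_setP => x y t t01 /KE[K'x x1] /KE[K'y y1]; apply/KE; split; first exact: cK'P.
  rewrite dotDl !dotZl; have /andP[t0 t1] := t01.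
  have : t * (1 - dot x phi) >= 0 by rewrite mulr_ge0// subr_ge0.
  have : (1 - t) * (1 - dot y phi) >= 0 by rewrite mulr_ge0// subr_ge0.
  lra.
apply: le_volume => z /(convex_hull_joinE cK K0)[t [k [t01 Kk zE]]].
have [K'k k1] := (KE k).1 Kk; have /andP[t0 t1] := t01.
have K'z : K' z by rewrite zE; exact: cK'P.
have [z1|z1] := leP (dot z phi) 1; [by left; apply/KE|right].
have r1 : 0 < dot p phi - 1 by rewrite subr_gt0.
have m0 : 0 < mu z by rewrite /mu divr_gt0// subr_gt0.
have mt : mu z <= 1 - t.
  rewrite /mu ler_pdivrMr// zE dotDl !dotZl.
  have : t * (1 - dot k phi) >= 0 by rewrite mulr_ge0// subr_ge0.
  lra.
have [m1|m1] := eqVneq (mu z) 1.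
  have t00 : t = 0 by lra.
  by rewrite /P/= m1 zE t00 scale0r add0r subr0 subrr.
have lt1 : 0 < 1 - mu z by rewrite subr_gt0 lt_neqAle m1/=; lra.
pose q := (t / (1 - mu z)) *: k + (1 - t / (1 - mu z)) *: p.
have yE : z - mu z *: p = (1 - mu z) *: q.
  rewrite /q scalerDr !scalerA {1}zE -addrA -scaleNr -scalerDl.
  by congr (_ *: _ + _ *: _); field; exact: lt0r_neq0.
rewrite /P/= yE; apply: K'D.
- apply: cK'P => //; rewrite divr_ge0 ?(ltW lt1)//= ler_pdivrMr// mul1r; lra.
- have yphi : dot (z - mu z *: p) phi = 1 - mu z.
    by rewrite -scaleNr dotDl dotZl /mu; field.
  by apply: (mulfI (lt0r_neq0 lt1)); rewrite -dotZl -yE yphi mulr1.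
- by apply/andP; split; lra.
Qed.
End facet_pyramids.

(** * Illumination bodies and polars *)

Section illumination.
Context {R : realType}.

Lemma convex_halfspace_pos n (u : 'rV[R]_n) c :
  @convex_set R 'rV[R]_n (halfspace_pos u c).
Proof.
apply/convex_setP => x y t /andP[t0 t1]; rewrite /halfspace_pos/= dotDl !dotZl => xc yc.
have : t * (c - dot x u) >= 0 by rewrite mulr_ge0// subr_ge0.
have : (1 - t) * (c - dot y u) >= 0 by rewrite mulr_ge0// subr_ge0.
lra.
Qed.

Lemma convex_bigcap n I (D : set I) (F : I -> set 'rV[R]_n) :
  (forall i, D i -> @convex_set R 'rV[R]_n (F i)) ->
  @convex_set R 'rV[R]_n (\bigcap_(i in D) F i).
Proof.
move=> cF; apply/convex_setP => x y t t01 Fx Fy i Di.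
by have /convex_setP := cF i Di; apply => //; [exact: Fx|exact: Fy].
Qed.

Definition sign_vector n (e : 'rV[R]_n) := forall i, `|e 0 i| = 1.

Definition signs n (x : 'rV[R]_n) : 'rV[R]_n := \row_i (if 0 <= x 0 i then 1 else -1).

Lemma sign_vector_signs n (x : 'rV[R]_n) : sign_vector (signs x).
Proof. by move=> i; rewrite mxE; case: ifP; rewrite ?normrN normr1. Qed.

Lemma signsM n (x : 'rV[R]_n) i : signs x 0 i * x 0 i = `|x 0 i|.
Proof.
rewrite mxE; case: ifPn => [x0|]; first by rewrite mul1r ger0_norm.
by rewrite -ltNge => x0; rewrite mulN1r ltr0_norm.
Qed.

Lemma dot_signs n (x : 'rV[R]_n) : dot x (signs x) = l1norm x.
Proof. by apply: eq_bigr => i _; rewrite mulrC signsM. Qed.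

Lemma ler_sign_norm (s a : R) : `|s| = 1 -> s * a <= `|a|.
Proof. by move=> s1; rewrite -[`|a|]mul1r -s1 -normrM ler_norm. Qed.

Lemma dot_sign_le n (x e : 'rV[R]_n) : sign_vector e -> dot x e <= l1norm x.
Proof. by move=> e1; apply: ler_sum => i _; rewrite mulrC ler_sign_norm. Qed.

Lemma sign_sqr (s : R) : `|s| = 1 -> s * s = 1.
Proof. by move=> s1; rewrite -expr2 -real_normK ?num_real// s1 expr1n. Qed.

Lemma cross_polytopeP n (x : 'rV[R]_n) : cross_polytope R n x <->
  forall e, sign_vector e -> dot x e <= 1.
Proof.
split => [x1 e e1|H]; first exact: le_trans (dot_sign_le _ e1) x1.
rewrite /cross_polytope/= -[\sum_i _]/(l1norm x) -dot_signs.
exact/H/sign_vector_signs.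
Qed.

Lemma convex_cross_polytope n : @convex_set R 'rV[R]_n (cross_polytope R n).
Proof.
rewrite (_ : cross_polytope R n = \bigcap_(e in @sign_vector n) halfspace_pos e 1).
  by apply: convex_bigcap => e _; exact: convex_halfspace_pos.
by apply/seteqP; split => x; rewrite cross_polytopeP.
Qed.

Lemma l1norm_delta n (i : 'I_n) (s : R) : l1norm (s *: delta_mx 0 i : 'rV[R]_n) = `|s|.
Proof.
rewrite /l1norm (bigD1 i)//= !mxE !eqxx mulr1 big1 ?addr0// => j ji.
by rewrite !mxE (negbTE ji) mulr0 normr0.
Qed.

Lemma polar_cube n : polar (cube R n) = cross_polytope R n.
Proof.
apply/seteqP; split => y.
  move=> Hy; apply/cross_polytopeP => e e1; rewrite dotC; apply: Hy.
  by apply/cubeP => i; rewrite e1.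
move=> y1 x /cubeP x1; apply: le_trans y1; apply: ler_sum => i _.
by rewrite (le_trans (ler_norm _))// normrM ler_piMl.
Qed.

Lemma polar_cross_polytope n : polar (cross_polytope R n) = cube R n.
Proof.
apply/seteqP; split => y.
  move=> Hy; apply/cubeP => i; rewrite -signsM -(dot_delta y) dotC -dotZl; apply: Hy.
  by rewrite /cross_polytope/= -[\sum_i _]/(l1norm _) l1norm_delta sign_vector_signs.
move=> /cubeP y1 x x1; apply: le_trans x1; apply: ler_sum => i _.
by rewrite (le_trans (ler_norm _))// normrM ler_piMr.
Qed.

Lemma illumination_body_sub n (K : set 'rV[R]_n) d :
  @convex_set R 'rV[R]_n K -> 0 <= d -> K `<=` illumination_body K d.
Proof.
move=> cK d0 x Kx; apply: (@le_trans _ _ (volume K)).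
  by apply: le_volume; apply: smallest_sub => // y [|->].
by rewrite -[leLHS]mul1e lee_wpmul2r ?volume_ge0// lee_fin lerDl.
Qed.

Lemma l1norm_eq0 n (x : 'rV[R]_n) : l1norm x = 0 -> x = 0.
Proof.
move=> /eqP; rewrite psumr_eq0// => /allP x0; apply/rowP => i; rewrite mxE; apply/eqP.
by rewrite -normr_eq0; exact: x0 (mem_index_enum i).
Qed.

Section cross.
Variables (n : nat) (e : 'rV[R]_n).
Hypothesis e1 : sign_vector e.

Let D := [set z : 'rV[R]_n | corner_simplex (\row_i (z 0 i * e 0 i) + 0)].

Let e_neq0 i : e 0 i != 0.
Proof. by rewrite -normr_eq0 e1 oner_eq0. Qed.

Let bS : borel (@corner_simplex R n) := @borel_corner_simplex R n.

Let bD : borel D.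
Proof.
have := borel_affine (diag_mx e) 0 bS; congr borel; apply/seteqP; split => x;
rewrite /D/= (_ : \row_i _ = x *m diag_mx e)//; by apply/rowP => i; rewrite mul_mx_diag !mxE.
Qed.

Let volD : volume D = (n`!%:R^-1)%:E.
Proof.
rewrite [LHS](volume_diag 0 e_neq0 bS) volume_corner_simplex normr_prod.
by rewrite big1 ?invr1 ?mul1e// => i _; exact: e1.
Qed.

Let DP z : D z <-> (forall i, 0 <= e 0 i * z 0 i) /\ dot z e <= 1.
Proof.
rewrite /D/= addr0 /corner_simplex/= (eq_bigr (fun i => z 0 i * e 0 i)).
  by split => -[H ?]; split => // i; have := H i; rewrite !mxE mulrC.
by move=> i _; rewrite mxE.
Qed.

Let D_dot z : D z -> 0 <= dot z e <= 1.
Proof.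
by move=> /DP[H ->]; rewrite andbT sumr_ge0// => i _; rewrite mulrC.
Qed.

Let D_l1norm z : D z -> l1norm z = dot z e.
Proof.
move=> /DP[H _]; apply: eq_bigr => i _; rewrite mulrC -(ger0_norm (H i)).
by rewrite normrM e1 mul1r.
Qed.

Let D_cone y : D y -> exists2 k, cross_polytope R n k & y = dot y e *: k.
Proof.
move=> Dy; rewrite -D_l1norm//; have [y0|y0] := eqVneq (l1norm y) 0.
  exists 0; last by rewrite scaler0; exact: l1norm_eq0.
  by rewrite /cross_polytope/= big1 ?ler01// => i _; rewrite mxE normr0.
exists ((l1norm y)^-1 *: y); last by rewrite scalerA divff// scale1r.
rewrite /cross_polytope/= -[\sum_i _]/(l1norm _) l1normZ ger0_norm ?invr_ge0 ?l1norm_ge0//.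
by rewrite mulVf.
Qed.

Let cross_dot (z : 'rV[R]_n) : cross_polytope R n z -> dot z e <= 1.
Proof. by move=> /cross_polytopeP; exact. Qed.

(** The pyramid over the facet [e] alone already adds the fraction
    [(<x, e> - 1) / 2 ^ n] of the volume. *)
Lemma illumination_cross_dot d x : illumination_body (cross_polytope R n) d x ->
  0 <= d -> dot x e <= 1 + 2 ^+ n * d.
Proof.
move=> Ix d0; have [x1|x1] := leP (dot x e) 1.
  by apply: (le_trans x1); rewrite lerDl mulr_ge0// exprn_ge0.
have := le_trans (volume_hull_ge (@borel_cross_polytope R n) bD cross_dot D_dot x1 D_cone) Ix.
rewrite volD volume_cross_polytope.
have f0 : 0 < n`!%:R^-1 :> R by rewrite invr_gt0 ltr0n fact_gt0.
rewrite -EFinM -EFinD -EFinM lee_fin mulrA -mulrDl ler_pM2r//; lra.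
Qed.

(** If each [e_i p_i] is at least [(<p, e> - 1) / 2], changing any sign of [e]
    brings [<p, e>] down to at most 1, so [e] is the only facet visible from [p]. *)
Lemma illumination_cross_test d (p : 'rV[R]_n) : 1 < dot p e <= 1 + 2 ^+ n * d ->
  (forall i, dot p e - 1 <= 2 * (e 0 i * p 0 i)) ->
  illumination_body (cross_polytope R n) d p.
Proof.
move=> /andP[p1 pd] Hp.
pose K' := \bigcap_(h in [set h : 'rV[R]_n | sign_vector h /\ h != e]) halfspace_pos h 1.
have cK' : @convex_set R 'rV[R]_n K'.
  by apply: convex_bigcap => h _; exact: convex_halfspace_pos.
have ep i : 0 <= e 0 i * p 0 i by have := Hp i; lra.
have flip h i : sign_vector h -> h 0 i != e 0 i -> h 0 i = - e 0 i.
  move=> h1 hi; have := h1 i; have := e1 i.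
  have /eqP := sign_sqr (e1 i); rewrite -expr2 -(sign_sqr (h1 i)) -expr2 eqf_sqr.
  by rewrite eq_sym (negbTE hi)/= => /eqP ->; rewrite opprK.
have K'p : K' p.
  move=> h [h1 he]; rewrite /halfspace_pos/=.
  have [i hi] : exists i, h 0 i != e 0 i.
    apply/existsP; apply: contraR he; rewrite negb_exists => /forallP he.
    by apply/eqP/rowP => i; apply/eqP; have := he i; rewrite negbK.
  suff : dot p h <= dot p e - 2 * (e 0 i * p 0 i) by have := Hp i; lra.
  rewrite /dot (bigD1 i)//= [X in _ <= X - _](bigD1 i)//= (flip h i h1 hi).
  suff : \sum_(j < n | j != i) p 0 j * h 0 j <= \sum_(j < n | j != i) p 0 j * e 0 j by lra.
  apply: ler_sum => j _; have [->//|hj] := eqVneq (h 0 j) (e 0 j).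
  by rewrite (flip h j h1 hj) mulrN; have := ep j; rewrite mulrC; lra.
have KE z : cross_polytope R n z <-> K' z /\ dot z e <= 1.
  split=> [z1|[K'z z1]].
    by split; [move=> h [h1 _]; exact: (cross_polytopeP z).1|exact: cross_dot].
  apply/cross_polytopeP => h h1; have [->//|he] := eqVneq h e.
  exact: K'z.
have D0 : D 0.
  by apply/DP; split => [i|]; rewrite ?mxE ?mulr0// /dot big1// => i _; rewrite mxE mul0r.
have K'D q t : K' q -> dot q e = 1 -> 0 <= t <= 1 -> D (t *: q).
  move=> K'q q1 /andP[t0 t1]; apply/DP; rewrite dotZl q1 mulr1; split => // i.
  rewrite mxE mulrCA mulr_ge0//.
  pose h : 'rV[R]_n := \row_j (if j == i then - e 0 j else e 0 j).
  have h1 : sign_vector h by move=> j; rewrite mxE; case: ifP; rewrite ?normrN.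
  have he : h != e.
    apply/eqP => /rowP/(_ i); rewrite mxE eqxx => /eqP; rewrite eq_sym -addr_eq0 => /eqP.
    by have := e_neq0 i; lra.
  have := K'q h (conj h1 he); rewrite /halfspace_pos/= -[X in _ <= X]q1 /dot.
  rewrite (bigD1 i)//= [X in _ <= X](bigD1 i)//= !mxE eqxx.
  rewrite (eq_bigr (fun j => q 0 j * e 0 j)); last by move=> j ji; rewrite mxE (negbTE ji).
  by rewrite mulrC; lra.
have K0 : (cross_polytope R n) !=set0.
  by exists 0; rewrite /cross_polytope/= big1 ?ler01// => i _; rewrite mxE normr0.
have := volume_hull_le (@borel_cross_polytope R n) bD p1 cK' K'p KE D0 K'D K0.
move=> /le_trans; apply; rewrite volD volume_cross_polytope.
have f0 : 0 < n`!%:R^-1 :> R by rewrite invr_gt0 ltr0n fact_gt0.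
rewrite -EFinM -EFinD -EFinM lee_fin mulrA -mulrDl ler_pM2r//; lra.
Qed.
End cross.

Section cube.
Variables (n : nat) (i : 'I_n) (s : R).
Hypothesis s1 : `|s| = 1.

Let phi : 'rV[R]_n := s *: delta_mx 0 i.

Let dot_phi z : dot z phi = s * z 0 i.
Proof. by rewrite dotC dotZl dotC dot_delta. Qed.

Let n0 : (0 < n)%N.
Proof. exact: leq_ltn_trans (leq0n _) (ltn_ord i). Qed.

Let ss : s * s = 1 := sign_sqr s1.

Let D_dot z : pyramid i s z -> 0 <= dot z phi <= 1.
Proof. by rewrite dot_phi => -[]. Qed.

Let cube_dot (z : 'rV[R]_n) : cube R n z -> dot z phi <= 1.
Proof. by move=> /cubeP z1; rewrite dot_phi (le_trans (ler_sign_norm _ s1)). Qed.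

Let D_cone y : pyramid i s y -> exists2 k, cube R n k & y = dot y phi *: k.
Proof.
move=> [/andP[y0 y1] H]; rewrite dot_phi; have [z0|z0] := eqVneq (s * y 0 i) 0.
  exists 0; first by apply/cubeP => j; rewrite mxE normr0.
  by apply/rowP => j; rewrite z0 !mxE mul0r; apply/eqP; rewrite -normr_le0 -z0.
exists ((s * y 0 i)^-1 *: y); last by rewrite scalerA divff// scale1r.
apply/cubeP => j; rewrite mxE normrM normfV (ger0_norm y0) ler_pdivrMl ?mulr1//.
by rewrite lt_neqAle eq_sym z0.
Qed.

Let vE : 2 ^+ n = 2 * 2 ^+ n.-1 :> R.
Proof. by rewrite -exprS prednK. Qed.

Let nR : 0 < n%:R :> R.
Proof. by rewrite ltr0n. Qed.

(** The pyramid over the facet [s x_i = 1] alone already adds the fraction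
    [(s x_i - 1) / (2 n)] of the volume. *)
Lemma illumination_cube_coord d x : illumination_body (cube R n) d x ->
  0 <= d -> s * x 0 i <= 1 + 2 * n%:R * d.
Proof.
move=> Ix d0; have [x1|] := leP (s * x 0 i) 1.
  by apply: (le_trans x1); rewrite lerDl !mulr_ge0.
rewrite -dot_phi => x1.
have := le_trans (volume_hull_ge (@borel_cube R n) (@borel_pyramid R n i s) cube_dot D_dot x1
    D_cone) Ix.
rewrite volume_pyramid// volume_cube -EFinM -EFinD -EFinM lee_fin vE => H.
have p0 : 0 < 2 ^+ n.-1 / n%:R :> R by rewrite divr_gt0// exprn_gt0.
rewrite -lerBlDl -(ler_pM2r p0).
have -> : 2 * n%:R * d * (2 ^+ n.-1 / n%:R) = 2 * d * 2 ^+ n.-1 :> R by field; exact: lt0r_neq0.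
lra.
Qed.

Lemma illumination_cube_test d (p : 'rV[R]_n) : 1 < s * p 0 i <= 1 + 2 * n%:R * d ->
  (forall j, j != i -> `|p 0 j| <= 1) ->
  illumination_body (cube R n) d p.
Proof.
move=> /andP[+ pd] Hp; rewrite -dot_phi => p1.
pose K' := [set z : 'rV[R]_n | -1 <= s * z 0 i /\ forall j, j != i -> `|z 0 j| <= 1].
have cK' : @convex_set R 'rV[R]_n K'.
  apply/convex_setP => x y t /andP[t0 t1] [xi xj] [yi yj]; split.
    rewrite !mxE mulrDr ![s * (_ * _)]mulrCA.
    have : t * (s * x 0 i + 1) >= 0 by rewrite mulr_ge0//; lra.
    have : (1 - t) * (s * y 0 i + 1) >= 0 by rewrite mulr_ge0//; lra.
    lra.
  move=> j ji; rewrite !mxE; apply: (le_trans (ler_normD _ _));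
      rewrite !normrM (ger0_norm t0) (@ger0_norm _ (1 - t)); last lra.
  have : t * (1 - `|x 0 j|) >= 0 by rewrite mulr_ge0// subr_ge0 xj.
  have : (1 - t) * (1 - `|y 0 j|) >= 0 by rewrite mulr_ge0// subr_ge0 ?yj.
  lra.
have K'p : K' p by split=> //; move: p1; rewrite dot_phi; lra.
have KE z : cube R n z <-> K' z /\ dot z phi <= 1.
  rewrite cubeP dot_phi; split => [z1|[[zi zj] z1] j].
    have : `|s * z 0 i| <= 1 by rewrite normrM s1 mul1r.
    by rewrite ler_norml => /andP[h1 h2]; split => //; split.
  have [->|/zj//] := eqVneq j i.
  have : `|s * z 0 i| <= 1 by rewrite ler_norml zi z1.
  by rewrite normrM s1 mul1r.
have D0 : pyramid i s 0 by split; [|move=> j]; rewrite !mxE mulr0 ?lexx ?ler01// normr0.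
have K'D q t : K' q -> dot q phi = 1 -> 0 <= t <= 1 -> pyramid i s (t *: q).
  move=> [qi qj]; rewrite dot_phi => q1 t01; have /andP[t0 t1] := t01.
  rewrite /pyramid/= mxE mulrCA q1 mulr1; split => // j; rewrite mxE normrM (ger0_norm t0).
  have [->|/qj ?] := eqVneq j i; last by rewrite ler_piMr.
  by have := congr1 Num.norm q1; rewrite normrM s1 mul1r normr1 => ->; rewrite mulr1.
have K0 : (cube R n) !=set0 by exists 0; apply/cubeP => j; rewrite mxE normr0.
have := volume_hull_le (@borel_cube R n) (@borel_pyramid R n i s) p1 cK' K'p KE D0 K'D K0.
move=> /le_trans; apply; rewrite volume_pyramid// volume_cube -EFinM -EFinD -EFinM lee_fin vE
    dot_phi.
have p0 : 0 < 2 ^+ n.-1 / n%:R :> R by rewrite divr_gt0// exprn_gt0.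
have : (s * p 0 i - 1) * (2 ^+ n.-1 / n%:R) <= 2 * n%:R * d * (2 ^+ n.-1 / n%:R).
  by rewrite ler_pM2r//; lra.
have -> : 2 * n%:R * d * (2 ^+ n.-1 / n%:R) = 2 * d * 2 ^+ n.-1 :> R by field; exact: lt0r_neq0.
lra.
Qed.
End cube.
End illumination.

(** * Cuts of the cube *)

Section floating_cube.
Context {R : realType}.

Lemma floating_body_mem n (K : set 'rV[R]_n) d x :
  (forall u c, u != 0 -> c < dot x u ->
    (d%:E * volume K < volume (K `&` halfspace_neg u c))%E) ->
  floating_body K d x.
Proof.
move=> H [u c] /= [u0 uc]; rewrite /halfspace_pos/= leNgt; apply/negP => /(H _ _ u0).
by rewrite ltNge uc.
Qed.

Lemma floating_cube_cap n d h (x : 'rV[R]_n) : (0 < n)%N -> 0 < h ->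
  (n%:R * h) ^+ n = n`!%:R * 2 ^+ n * d ->
  floating_body (cube R n) d x -> dot x (const_mx 1) <= n%:R * (1 - h).
Proof.
move=> n0 h0 hd /(_ (const_mx 1, n%:R * (1 - h))); apply; split => /=.
  by case: n n0 {hd x} => // n _; apply/eqP => /rowP/(_ 0); rewrite !mxE; exact/eqP/oner_neq0.
have nh0 : 0 < n%:R * h by rewrite mulr_gt0// ltr0n.
set c := (n%:R * h)^-1; have c0 : 0 < c by rewrite invr_gt0.
apply: (@le_trans _ _ (volume [set y : 'rV[R]_n | corner_simplex (- c *: y + c *: const_mx 1)])).
  apply: le_volume => y [/cubeP y1]; rewrite /halfspace_neg/= => hy; split.
    move=> i; rewrite !mxE mulNr addrC -mulrBr mulr_ge0 ?(ltW c0)// subr_ge0.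
    by have := y1 i; rewrite ler_norml => /andP[].
  rewrite (eq_bigr (fun i => c - c * y 0 i)); last by move=> i _; rewrite !mxE; ring.
  rewrite sumrB -mulr_sumr sumr_const card_ord -mulr_natl.
  have -> : \sum_i y 0 i = dot y (const_mx 1) by apply: eq_bigr => i _; rewrite mxE mulr1.
  rewrite mulrC -mulrBr /c ler_pdivrMl// mulr1; lra.
rewrite volume_dilate ?oppr_eq0 ?gt_eqF//; last exact: borel_corner_simplex.
rewrite volume_corner_simplex volume_cube normrN gtr0_norm// /c exprVn invrK hd -!EFinM lee_fin.
have f0 : n`!%:R != 0 :> R by rewrite pnatr_eq0 -lt0n fact_gt0.
by rewrite [leLHS](_ : _ = d * 2 ^+ n)//; field.
Qed.

(** A half-space containing [x] cuts off at least the corner simplex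
    [sum_i v_i w_i <= 1], [w_i = 1 - e_i y_i], where [v_i >= 1/2] keeps it within
    the cube; the product of the intercepts is controlled by the inequality of
    arithmetic and geometric means. *)
Lemma volume_cube_cut n (e u x : 'rV[R]_n) c : (0 < n)%N -> u != 0 ->
  sign_vector e -> (forall i, e 0 i * u 0 i = `|u 0 i|) ->
  (forall i, 0 < 1 - e 0 i * x 0 i) -> c <= dot x u ->
  ((n%:R ^+ n * \prod_i (1 - e 0 i * x 0 i) /
     (n`!%:R * (1 + (\sum_i (1 - e 0 i * x 0 i)) / 2) ^+ n))%:E <=
   volume (cube R n `&` halfspace_neg u c))%E.
Proof.
move=> n0 u0 e1 eu t0 cx; pose t i := 1 - e 0 i * x 0 i.
have {}t0 i : 0 < t i by exact: t0.
rewrite -[\prod_i _]/(\prod_i t i) -[\sum_i _]/(\sum_i t i).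
pose s := \sum_i `|u 0 i| * t i.
have s0 : 0 < s.
  rewrite lt_neqAle sumr_ge0 ?andbT; last by move=> i _; rewrite mulr_ge0// ltW.
  rewrite eq_sym; apply: contraNN u0; rewrite psumr_eq0; last by move=> i _;
      rewrite mulr_ge0// ltW.
  move=> /allP H; apply/eqP/rowP => i; rewrite mxE; apply/eqP.
  by have := H i (mem_index_enum i); rewrite mulf_eq0 (gt_eqF (t0 i)) orbF normr_eq0.
pose v i := Num.max (`|u 0 i| / s) (2^-1).
have v0 i : 0 < v i by rewrite /v lt_max invr_gt0 ltr0n orbT.
have vu i : `|u 0 i| / s <= v i by rewrite /v le_max lexx.
have vh i : 2^-1 <= v i by rewrite /v le_max lexx orbT.
have T0 : 0 <= \sum_i t i by apply: sumr_ge0 => i _; exact: ltW.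
have vT : \sum_i v i * t i <= 1 + (\sum_i t i) / 2.
  have E1 : \sum_i (`|u 0 i| / s) * t i = 1.
    rewrite (eq_bigr (fun i => s^-1 * (`|u 0 i| * t i))) -?mulr_sumr ?mulVf ?gt_eqF// => i _.
    by rewrite mulrCA mulrA.
  rewrite -[X in _ <= X + _]E1 mulr_suml -big_split/=; apply: ler_sum => i _.
  rewrite /v [t i / 2]mulrC -mulrDl ler_wpM2r ?(ltW (t0 i))//.
  by rewrite ge_max lerDl lerDr invr_ge0 ler0n divr_ge0// ltW.
pose d : 'rV[R]_n := \row_i (- (e 0 i * v i)).
pose b : 'rV[R]_n := \row_i v i.
apply: (@le_trans _ _ (volume [set y : 'rV[R]_n | corner_simplex (\row_i (y 0 i * d 0 i) +
    b)])); last first.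
  apply: le_volume => y [Hw Hs].
  pose w i := 1 - e 0 i * y 0 i.
  have wE i : (\row_i (y 0 i * d 0 i) + b) 0 i = v i * w i by rewrite !mxE /w; ring.
  have w0 i : 0 <= w i by have := Hw i; rewrite wE pmulr_rge0.
  have {}Hs : \sum_i v i * w i <= 1 by rewrite -(eq_bigr _ (fun i _ => wE i)).
  split.
    apply/cubeP => i.
    have : v i * w i <= 1.
      apply: le_trans Hs; rewrite (bigD1 i)//= lerDl sumr_ge0// => j _.
      by rewrite mulr_ge0// ltW.
    have : 2^-1 * w i <= v i * w i by rewrite ler_wpM2r.
    move=> h1 h2; have : `|e 0 i * y 0 i| <= 1.
      by rewrite ler_norml; have := w0 i; rewrite /w in h1 h2 *; lra.
    by rewrite normrM e1 mul1r.
  rewrite /halfspace_neg/=; apply: (le_trans cx).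
  have dE z : dot z u = \sum_i `|u 0 i| - \sum_i `|u 0 i| * (1 - e 0 i * z 0 i).
    rewrite -sumrB; apply: eq_bigr => i _.
    by rewrite -eu; have := sign_sqr (e1 i); move: (e 0 i) (z 0 i) (u 0 i) => a q r aa;
        rewrite mulrBr mulr1 opprB addrC subrK mulrCA mulrA mulrA aa mul1r mulrC.
  rewrite !dE lerD2l lerN2 -/s.
  have -> : \sum_i `|u 0 i| * (1 - e 0 i * y 0 i) = s * \sum_i (`|u 0 i| / s) * w i.
    by rewrite mulr_sumr; apply: eq_bigr => i _; rewrite /w; field; exact: lt0r_neq0.
  rewrite -[leRHS]mulr1 ler_pM2l//; apply: le_trans Hs.
  by apply: ler_sum => i _; rewrite ler_wpM2r.
have d0 i : d 0 i != 0.
  have e0 : e 0 i != 0 by rewrite -normr_eq0 e1 oner_eq0.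
  by rewrite mxE oppr_eq0 mulf_neq0// gt_eqF.
rewrite [leRHS](volume_diag b d0 (@borel_corner_simplex R n)).
rewrite volume_corner_simplex -EFinM lee_fin normr_prod.
have -> : \prod_i `|d 0 i| = \prod_i v i.
  by apply: eq_bigr => i _; rewrite mxE normrN normrM e1 mul1r gtr0_norm.
have pv : 0 < \prod_i v i by apply: prodr_gt0.
have pt : 0 < \prod_i t i by apply: prodr_gt0.
have f0 : 0 < n`!%:R :> R by rewrite ltr0n fact_gt0.
have T1 : 0 < 1 + (\sum_i t i) / 2 by rewrite ltr_pwDl// divr_ge0.
have nR : 0 < n%:R :> R by rewrite ltr0n.
have AM : \prod_i (v i * t i) <= ((1 + (\sum_i t i) / 2) / n%:R) ^+ n.
  apply: (@le_trans _ _ (((\sum_i v i * t i) / n%:R) ^+ n)).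
    have [] := @leif_AGM R 'I_n predT (fun i => v i * t i); last first.
      by rewrite (_ : #|_| = n) // -[RHS]card_ord; apply: eq_card.
    by move=> i _; rewrite mulr_ge0// ltW.
  rewrite lerXn2r ?nnegrE ?divr_ge0 ?ler_pM2r ?invr_gt0// ?(ltW T1)//.
  by apply: sumr_ge0 => i _; rewrite mulr_ge0// ltW.
rewrite big_split/= in AM.
rewrite expr_div_n ler_pdivlMr ?exprn_gt0// in AM.
rewrite ler_pdivrMr ?mulr_gt0 ?exprn_gt0//.
have -> : (\prod_i v i)^-1 * n`!%:R^-1 * (n`!%:R * (1 + (\sum_i t i) / 2) ^+ n) =
    (1 + (\sum_i t i) / 2) ^+ n / \prod_i v i.
  by field; rewrite !lt0r_neq0.
by rewrite ler_pdivlMr// (le_trans _ AM)// [leLHS]mulrC [n%:R ^+ n * _]mulrC mulrA.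
Qed.
End floating_cube.

(** * Cuts of the cross-polytope *)

Section floating_cross_polytope.
Context {R : realType}.

(** The cap of the cross-polytope at the vertex [s e_i]. *)
Definition cross_cap n (i : 'I_n) (s h : R) : set 'rV[R]_n :=
  [set x | cross_polytope R n x /\ 1 - h <= s * x 0 i].

Lemma borel_cross_cap n (i : 'I_n) s h : borel (cross_cap i s h).
Proof.
apply: borelI; first exact: borel_cross_polytope.
apply: borel_le; first exact: borel_fun_cst.
by apply: borel_funM; [exact: borel_fun_cst|exact: borel_fun_coord].
Qed.

Lemma volume_cross_cap n (i : 'I_n.+1) s h : `|s| = 1 -> 0 < h <= 1 ->
  volume (cross_cap i s h) = (h ^+ n.+1 * 2 ^+ n / n.+1`!%:R)%:E.
Proof.
move=> s1 /andP[h0 h1].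
pose e : 'rV[R]_n.+1 := delta_mx 0 0.
pose C := [set x : 'rV[R]_n.+1 | @l1_cone R n (- h^-1 *: x + h^-1 *: e)].
have bC : borel C.
  have := borel_affine ((- h^-1)%:M) (h^-1 *: e) (@borel_l1_cone R n).
  by congr borel; apply/seteqP; split => x; rewrite /C/= mul_mx_scalar.
have -> : cross_cap i s h = [set x | C (\row_j (s * x 0 (tperm 0 i j)))].
  have hE x : C x <-> cross_polytope R n.+1 x /\ 1 - h <= x 0 0.
    have x0E : (- h^-1 *: x + h^-1 *: e) 0 0 = h^-1 * (1 - x 0 0) by rewrite !mxE !eqxx mulr1
        mulrBr mulr1 mulNr addrC.
    have lE : l1norm (- h^-1 *: x + h^-1 *: e) =
        h^-1 * (`|1 - x 0 0| + \sum_(j < n) `|x 0 (lift 0 j)|).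
      rewrite /l1norm big_ord_recl x0E normrM (@gtr0_norm _ h^-1) ?invr_gt0// mulrDr.
      rewrite mulr_sumr; congr (_ + _); apply: eq_bigr => j _.
      by rewrite !mxE mulr0 addr0 mulNr normrN normrM gtr0_norm ?invr_gt0.
    rewrite /C/l1_cone/= x0E lE /cross_polytope/= big_ord_recl.
    set y := \sum_(j < n) _; have y0 : 0 <= y by apply: sumr_ge0.
    rewrite ler_pdivrMl// mulr1 mulrCA ler_pM2l ?invr_gt0// pmulr_rge0 ?invr_gt0//.
    split => [[/andP[x1 x2]]|[x1 x2]].
      by rewrite !ger0_norm//; [split; lra|lra].
    have x00 : 0 <= x 0 0 by lra.
    rewrite (ger0_norm x00) in x1.
    by rewrite ger0_norm; [split; [apply/andP; split|]; lra|lra].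
  have lE (x : 'rV[R]_n.+1) :
      cross_polytope R n.+1 (\row_j (s * x 0 (tperm 0 i j))) = cross_polytope R n.+1 x.
    rewrite /cross_polytope/=.
    rewrite [in RHS](reindex_inj (@perm_inj _ (tperm 0 i))); congr (is_true (_ <= _)).
    by apply: eq_bigr => j _; rewrite mxE normrM s1 mul1r.
  by apply/seteqP; split => x /=; rewrite hE lE mxE tpermL.
rewrite volume_signed_swap// volume_dilate; last 2 first.
- by rewrite oppr_eq0 invr_eq0 gt_eqF.
- exact: borel_l1_cone.
rewrite volume_l1_cone volume_cross_polytope -!EFinM; congr EFin.
rewrite normrN normfV gtr0_norm// exprVn invrK factS natrM invfM; ring.
Qed.

Lemma floating_cross_cap n d h (i : 'I_n.+1) (x : 'rV[R]_n.+1) : 0 < h <= 1 ->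
  h ^+ n.+1 = 2 * d ->
  floating_body (cross_polytope R n.+1) d x -> x 0 i <= 1 - h.
Proof.
move=> h01 hd /(_ (delta_mx 0 i, 1 - h)); rewrite /halfspace_pos/= dot_delta; apply; split => /=.
  by apply/eqP => /rowP/(_ i); rewrite !mxE !eqxx => /eqP; rewrite oner_eq0.
rewrite (_ : _ `&` _ = cross_cap i 1 h); last first.
  by apply/seteqP; split => y; rewrite /halfspace_neg/cross_cap/= dot_delta mul1r.
rewrite volume_cross_cap ?normr1// volume_cross_polytope -EFinM lee_fin hd exprS.
by rewrite [leLHS](_ : _ = d * (2 * 2 ^+ n / n.+1`!%:R))//; ring.
Qed.

(** Central reflection in the centre [(1 - h) s e_i] of the base of the cap maps
    the cap into the cross-polytope, on the other side of the base. The part of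
    the cap lost by tilting its base is thus regained on the other side. *)
Lemma volume_cross_cut n (i : 'I_n) s h u c : `|s| = 1 -> 0 < h <= 1 ->
  c < dot ((1 - h) *: (s *: delta_mx 0 i)) u ->
  (volume (cross_cap i s h) <= volume (cross_polytope R n `&` halfspace_neg u c))%E.
Proof.
move=> s1 /andP[h0 h1] cu; set z := (1 - h) *: _ in cu.
have ss := sign_sqr s1.
pose H := halfspace_neg u c.
have bH : borel H by apply: borel_le; [exact: borel_fun_cst|exact: borel_dot].
pose T := cross_cap i s h; have bT : borel T by exact: borel_cross_cap.
pose T1 := T `&` H.
pose T2 := [set y | (T `&` ~` H) (-1 *: y + 2 *: z)].
pose N := [set y : 'rV[R]_n | dot y (s *: delta_mx 0 i) = 1 - h].
have dotN y : dot y (s *: delta_mx 0 i) = s * y 0 i by rewrite dotC dotZl dotC dot_delta.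
have bN : borel N by exact: borel_hyperplane.
have N0 : volume N = 0%E.
  apply: volume_hyperplane; apply/eqP => /rowP/(_ i); rewrite !mxE !eqxx mulr1 => s0.
  by move: s1; rewrite s0 normr0 => /eqP; rewrite eq_sym oner_eq0.
have bTH : borel (T `&` ~` H) by apply: borelI => //; exact: borelC.
have bT1 : borel T1 by exact: borelI.
have bT2 : borel T2.
  have := borel_affine ((-1)%:M) (2 *: z) bTH.
  by congr borel; apply/seteqP; split => x; rewrite /T2/= mul_mx_scalar.
have vT2 : volume T2 = volume (T `&` ~` H).
  by rewrite volume_dilate ?oppr_eq0 ?oner_eq0// normrN normr1 expr1n invr1 mul1e.
have bT2N : borel (T2 `\` N) by apply: borelI => //; exact: borelC.
have -> : volume T = (volume T1 + volume T2)%E.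
  rewrite vT2 -volumeU//.
    by congr volume; rewrite /T1 -setIUr setUv setIT.
  by apply/seteqP; split => y // [[_ ?] [_]].
have zi : s * z 0 i = 1 - h by rewrite !mxE !eqxx mulr1 mulrCA ss mulr1.
have zj j : j != i -> z 0 j = 0 by move=> ji; rewrite !mxE (negbTE ji) andbF !mulr0.
have disj : T1 `&` (T2 `\` N) = set0.
  apply/seteqP; split => y // [[[_ y1] _] [[[_ y2] _]]]; apply; rewrite /N/= dotN.
  move: y2; rewrite mxE [(-1 *: y) 0 i]mxE [(2 *: z) 0 i]mxE mulrDr mulrCA [s * (2 * _)]mulrCA zi.
  by move=> y2; apply/le_anti/andP; split; lra.
rewrite (@le_trans _ _ (volume (T1 `|` (T2 `\` N))))//.
  by rewrite volumeU// (volumeD_null bT2 bN N0).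
apply: le_volume => y [[[y1 _] yH]//|[[[y1 yi] yH] _]]; split; last first.
  rewrite /halfspace_neg/=; have : ~ (c <= dot (-1 *: y + 2 *: z) u) := yH.
  by move=> /negP; rewrite -ltNge dotDl (dotZl (-1)) (dotZl 2); lra.
move: y1 yi; set y' := -1 *: y + 2 *: z => y1 yi.
have yE j : y 0 j = 2 * z 0 j - y' 0 j by rewrite /y' !mxE; ring.
have syE : s * y 0 i = 2 * (1 - h) - s * y' 0 i by rewrite yE mulrBr mulrCA zi.
have yi0 : `|y 0 i| = `|s * y 0 i| by rewrite normrM s1 mul1r.
have yi0' : `|y' 0 i| = s * y' 0 i by rewrite -[LHS]mul1r -s1 -normrM ger0_norm//; lra.
move: y1; rewrite /cross_polytope/= (bigD1 i)//= yi0' [X in _ -> X <= _](bigD1 i)//= yi0 syE.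
rewrite [X in _ -> _ + X <= _](eq_bigr (fun j => `|y' 0 j|)); last first.
  by move=> j ji; rewrite yE zj// mulr0 sub0r normrN.
set r := \sum_(j | _) _; have r0 : 0 <= r by apply: sumr_ge0.
by move=> y1; rewrite -lerBrDr ler_norml; lra.
Qed.

Lemma floating_cross_vertex n d h (i : 'I_n.+1) s : `|s| = 1 -> 0 < h <= 1 ->
  2 * d < h ^+ n.+1 -> floating_body (cross_polytope R n.+1) d ((1 - h) *: (s *: delta_mx 0 i)).
Proof.
move=> s1 h01 hd; apply: floating_body_mem => u c u0 cu.
apply: lt_le_trans (volume_cross_cut s1 h01 cu).
rewrite volume_cross_cap// volume_cross_polytope -EFinM lte_fin.
have f0 : 0 < 2 ^+ n / n.+1`!%:R :> R by rewrite divr_gt0 ?exprn_gt0// ltr0n fact_gt0.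
rewrite -[ltRHS]mulrA [ltLHS](_ : _ = 2 * d * (2 ^+ n / n.+1`!%:R)); first by rewrite ltr_pM2r.
by rewrite [2 ^+ n.+1]exprS; ring.
Qed.

(** A half-space containing the points [(1 - h) (+- e_i)] contains their convex
    hull. *)
Lemma floating_cross_dilate n d h (x : 'rV[R]_n.+1) : 0 < h < 1 -> 2 * d < h ^+ n.+1 ->
  l1norm x <= 1 - h -> floating_body (cross_polytope R n.+1) d x.
Proof.
move=> /andP[h0 h1] hd xh [u c] H; rewrite /halfspace_pos/=.
have uc i : (1 - h) * `|u 0 i| <= c.
  have h01 : 0 < h <= 1 by rewrite h0 ltW.
  have := floating_cross_vertex i (sign_vector_signs u i) h01 hd H.
  by rewrite /halfspace_pos/= !dotZl dotC dot_delta signsM.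
have c0 : 0 <= c.
  by apply: le_trans (uc 0); rewrite mulr_ge0// subr_ge0 ltW.
have h'0 : 0 < 1 - h by rewrite subr_gt0.
apply: (@le_trans _ _ (l1norm x * (c / (1 - h)))).
  rewrite /l1norm mulr_suml; apply: ler_sum => i _.
  rewrite (le_trans (ler_norm _))// normrM ler_wpM2l// ler_pdivlMr// mulrC; exact: uc.
have : l1norm x * (c / (1 - h)) <= (1 - h) * (c / (1 - h)).
  by rewrite ler_wpM2r// divr_ge0// ltW.
by rewrite [X in _ <= X -> _]mulrC divfK// gt_eqF.
Qed.
(** Near a point with two coordinates bounded away from 0, the cross-polytope
    contains a symmetric neighbourhood that is thin only in [n - 1] directions:
    its length is constant in the direction that moves mass from one of the two
    coordinates to the other, since this preserves the norm. *)
Lemma volume_cross_edge_cut n (i j : 'I_n) m th (x u : 'rV[R]_n) c :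
  i != j -> 0 < m -> m <= `|x 0 i| -> m <= `|x 0 j| ->
  0 < th -> th / n%:R <= m / 2 -> l1norm x <= 1 - th -> c < dot x u ->
  ((m / 2 * (2 * (th / n%:R)) ^+ n.-1)%:E <=
    volume (cross_polytope R n `&` halfspace_neg u c))%E.
Proof.
move=> ij m0 xi xj th0 thm x1 cu; set t := th / n%:R in thm *.
have n0 : (0 < n)%N by exact: leq_ltn_trans (leq0n _) (ltn_ord i).
have nR : 0 < n%:R :> R by rewrite ltr0n.
have t0 : 0 < t by exact: divr_gt0.
pose e := signs x; have e1 := sign_vector_signs x.
have ee k : e 0 k * e 0 k = 1 by apply: sign_sqr; exact: e1.
pose w : 'rV[R]_n := delta_mx 0 i.
pose v : 'rV[R]_n := (e 0 i * e 0 j) *: delta_mx 0 j.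
pose d : 'rV[R]_n := \row_k (if k == i then 2 / m else t^-1).
pose Q := [set y : 'rV[R]_n | cube R n (\row_k (y 0 k * d 0 k) + 0)].
pose b := - (x + dot x w *: v).
pose Qx := [set y | Q (y + dot y w *: v + b)].
have ji : j != i by rewrite eq_sym.
have vw : dot v w = 0 by rewrite dot_delta !mxE eqxx (negbTE ij) andbF mulr0.
have d0 k : d 0 k != 0.
  by rewrite mxE; case: ifP => _; rewrite ?mulf_neq0 ?invr_eq0 ?gt_eqF.
have bQ : borel Q.
  have := borel_affine (diag_mx d) 0 (@borel_cube R n); congr borel.
  by apply/seteqP; split => y; rewrite /Q/= (_ : \row_k _ = y *m diag_mx d)//;
    apply/rowP => k; rewrite mul_mx_diag !mxE.
have bQx : borel Qx.
  have := borel_affine (1%:M + w^T *m v) b bQ.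
  by congr borel; apply/seteqP; split => y; rewrite /= mulmx_rank1.
have vQ : volume Qx = (m * (2 * t) ^+ n.-1)%:E.
  rewrite [LHS]volume_rank1 ?vw ?addr0 ?oner_neq0// normr1 invr1 mul1e.
  rewrite [LHS](volume_diag 0 d0 (@borel_cube R n)) volume_cube -EFinM; congr EFin.
  rewrite (bigD1 i)//= mxE eqxx (eq_bigr (fun=> t^-1)); last by move=> k ki;
      rewrite mxE (negbTE ki).
  rewrite prodr_const (_ : #|_| = n.-1); last first.
    have := cardC1 i; rewrite card_ord => <-; exact: eq_card.
  rewrite gtr0_norm; last by rewrite mulr_gt0 ?divr_gt0 ?exprn_gt0 ?invr_gt0.
  have -> : 2 ^+ n = 2 * 2 ^+ n.-1 :> R by rewrite -exprS prednK.
  rewrite exprMn exprVn; field.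
  by rewrite gt_eqF ?exprn_gt0// gt_eqF.
pose H := halfspace_neg u c.
have bH : borel H by apply: borel_le; [exact: borel_fun_cst|exact: borel_dot].
have bQH : borel (Qx `&` H) by exact: borelI.
have coordE y k : (y + dot y w *: v + b) 0 k =
    (y 0 k - x 0 k) + (y 0 i - x 0 i) * (e 0 i * e 0 j) * (k == j)%:R.
  by rewrite /b /v !dot_delta !mxE eqxx/=; ring.
have QxP y : Qx y <-> forall k, `|((y 0 k - x 0 k) + (y 0 i - x 0 i) * (e 0 i * e 0 j) * (k ==
    j)%:R) * d 0 k| <= 1.
  rewrite /Qx /Q/= cubeP; split => h k; have := h k; rewrite addr0 mxE coordE//.
have Qrefl y : Qx y -> Qx (-1 *: y + 2 *: x).
  move=> /QxP Qy; apply/QxP => k; have := Qy k.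
  congr (is_true (_ <= _)); rewrite -normrN; congr `|_|; rewrite !mxE; ring.
have half : (volume Qx <= volume (Qx `&` H) + volume (Qx `&` H))%E.
  apply: (@le_trans _ _ (volume ((Qx `&` H) `|` [set y | (Qx `&` H) (-1 *: y + 2 *: x)]))).
    apply: le_volume => y Qy; have [yc|yc] := leP c (dot y u); first by left.
    right; split; first exact: Qrefl.
    by rewrite /H/halfspace_neg/= dotDl !dotZl; lra.
  have bR : borel [set y | (Qx `&` H) (-1 *: y + 2 *: x)].
    have := borel_affine ((-1)%:M) (2 *: x) bQH.
    by congr borel; apply/seteqP; split => y; rewrite /= mul_mx_scalar.
  apply: (le_trans (volumeU_le _ _)) => //.
  by rewrite volume_dilate ?oppr_eq0 ?oner_eq0// normrN normr1 expr1n invr1 mul1e.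
have dE k : d 0 k = if k == i then 2 / m else t^-1 by rewrite mxE.
have QK : Qx `<=` cross_polytope R n.
  move=> y /QxP Qy; pose z := y - x.
  have zE k : z 0 k = y 0 k - x 0 k by rewrite !mxE.
  have zi : `|z 0 i| <= m / 2.
    have := Qy i; rewrite (negbTE ij) mulr0 addr0 -zE dE eqxx normrM (@gtr0_norm _ (2 / m))
        ?divr_gt0//.
    by rewrite -ler_pdivlMr ?divr_gt0// invf_div mul1r.
  have zj : `|z 0 j + z 0 i * (e 0 i * e 0 j)| <= t.
    have := Qy j; rewrite eqxx mulr1 -!zE dE (negbTE ji) normrM (@gtr0_norm _ t^-1) ?invr_gt0//.
    by rewrite ler_pdivrMr// mul1r.
  have zk k : k != i -> k != j -> `|z 0 k| <= t.
    move=> ki kj; have := Qy k; rewrite (negbTE kj) mulr0 addr0 -zE dE (negbTE ki) normrM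
        (@gtr0_norm _ t^-1) ?invr_gt0//.
    by rewrite ler_pdivrMr// mul1r.
  have yE k : y 0 k = x 0 k + z 0 k by rewrite zE; ring.
  have eN k (a : R) : `|e 0 k * a| = `|a| by rewrite normrM e1 mul1r.
  have exk k : e 0 k * x 0 k = `|x 0 k| by exact: signsM.
  have yi : `|y 0 i| = `|x 0 i| + e 0 i * z 0 i.
    rewrite -(eN i) yE mulrDr exk ger0_norm//.
    by have := eN i (z 0 i); move=> zz; have := ler_norm (- (e 0 i * z 0 i));
        rewrite normrN zz; lra.
  have ejz : `|e 0 j * z 0 j + e 0 i * z 0 i| <= t.
    rewrite -(eN j) in zj; move: zj; congr (is_true (`|_| <= _)).
    by rewrite mulrDr; congr (_ + _); rewrite mulrC -!mulrA ee mulr1 mulrC.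
  have yj : `|y 0 j| = `|x 0 j| + e 0 j * z 0 j.
    rewrite -(eN j) yE mulrDr exk ger0_norm//.
    move: ejz; rewrite ler_norml => /andP[h1 h2].
    have := ler_norm (e 0 i * z 0 i); rewrite eN; lra.
  rewrite /cross_polytope/= (bigD1 i)//= (bigD1 j)//= yi yj.
  have : l1norm x = `|x 0 i| + (`|x 0 j| + \sum_(k < n | (k != i) && (k != j)) `|x 0 k|).
    by rewrite /l1norm (bigD1 i)//= (bigD1 j).
  have : \sum_(k < n | (k != i) && (k != j)) `|y 0 k| <=
      \sum_(k < n | (k != i) && (k != j)) (`|x 0 k| + t).
    apply: ler_sum => k /andP[ki kj]; rewrite yE.
    by apply: (le_trans (ler_normD _ _)); rewrite lerD2l zk.
  rewrite big_split/= sumr_const -mulr_natl.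
  set N := #|_|; have Nn : (N + 1)%:R * t <= th.
    rewrite /t mulrCA -[leRHS]mulr1 ler_pM2l// ler_pdivrMr// mul1r ler_nat addn1.
    rewrite /N -[n in (_ <= n)%N]card_ord; apply: (@leq_ltn_trans #|predC1 i|).
      by apply: subset_leq_card; apply/fintype.subsetP => k /andP[].
    by rewrite cardC1 card_ord prednK.
  rewrite natrD mulrDl mul1r in Nn.
  have := ler_norm (e 0 j * z 0 j + e 0 i * z 0 i).
  lra.
have : (volume (Qx `&` H) <= volume (cross_polytope R n `&` H))%E.
  by apply: le_volume => y [/QK].
apply: le_trans.
move: half; rewrite vQ.
case: (volume (Qx `&` H)) (volume_ge0 (Qx `&` H)) => [q| |]//= _.
- by rewrite -EFinD !lee_fin mulrAC; lra.
- by move=> _; rewrite leey.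
Qed.
End floating_cross_polytope.

(** * Estimates of the distance *)

Section distance_bounds.
Context {R : realType}.

Lemma dist_floating_illumination_ge n (S : set 'rV[R]_n) d L :
  (forall d' a, 0 < d' -> 1 <= a ->
    dilate a^-1 (floating_body S d) `<=` polar_illumination_body S d' ->
    polar_illumination_body S d' `<=` dilate a (floating_body S d) -> L <= a) ->
  (L%:E <= dist_floating_illumination S d)%E.
Proof.
move=> H; apply: le_ereal_inf_tmp => _ [d' d'0 <-];
    apply: le_ereal_inf_tmp => _ [a [a1 aP Pa] <-].
by rewrite lee_fin; exact: H Pa.
Qed.

Lemma dist_floating_illumination_le n (S : set 'rV[R]_n) d d' a :
  0 < d' -> 1 <= a ->
  dilate a^-1 (floating_body S d) `<=` polar_illumination_body S d' ->
  polar_illumination_body S d' `<=` dilate a (floating_body S d) ->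
  (dist_floating_illumination S d <= a%:E)%E.
Proof.
move=> d'0 a1 aP Pa.
apply: (@le_trans _ _ (dist_body (floating_body S d) (polar_illumination_body S d'))).
  by apply: ereal_inf_lbound; exists d'.
by apply: ereal_inf_lbound; exists a.
Qed.

Lemma floating_body_halfspace n (K : set 'rV[R]_n) phi c d x :
  phi != 0 -> 0 <= d -> (forall y, K y -> dot y phi <= c) ->
  floating_body K d x -> dot x phi <= c.
Proof.
move=> phi0 d0 Kc /(_ (phi, c)); apply; split => //=.
apply: (@le_trans _ _ (volume [set y | dot y phi = c])).
  by apply: le_volume => y [/Kc yc cy]; apply/le_anti; rewrite yc.
by rewrite volume_hyperplane// mule_ge0 ?volume_ge0.
Qed.

Lemma illumination_body_mono n (K : set 'rV[R]_n) d d' :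
  d <= d' -> illumination_body K d `<=` illumination_body K d'.
Proof.
move=> dd x Ix; apply: (le_trans Ix).
by rewrite lee_wpmul2r ?volume_ge0// lee_fin lerD2l.
Qed.

(** With [2 q = a s]: at the vertex, the polar body reaches at least
    [1 / (1 + q)] and the floating body stops at [1 - 2 q]. *)
Lemma distance_tradeoff1 (q a : R) : 0 <= q -> 2 * q < 1 ->
  (1 + q)^-1 <= a * (1 - 2 * q) -> 1 + q <= a.
Proof.
move=> q0 q1 h; rewrite leNgt; apply/negP => aq.
have : 1 <= a * (1 - 2 * q) * (1 + q) by rewrite -ler_pdivrMr ?div1r//; lra.
have h2 : 0 < (1 - 2 * q) * (1 + q) by rewrite mulr_gt0//; lra.
have : a * ((1 - 2 * q) * (1 + q)) < (1 + q) * ((1 - 2 * q) * (1 + q)) by rewrite ltr_pM2r.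
have : 0 <= q ^+ 2 by exact: sqr_ge0.
have : 0 <= q ^+ 3 by exact: exprn_ge0.
rewrite !exprS expr0; nra.
Qed.

Lemma inv_le_quadratic (x : R) : 0 <= x -> (1 + x)^-1 <= 1 - x + x ^+ 2.
Proof.
move=> x0; rewrite -div1r ler_pdivrMr; last by lra.
have : 0 <= x ^+ 3 by exact: exprn_ge0.
rewrite !exprS expr0; nra.
Qed.

(** Next to the vertex, the floating body reaches [1 - eps s / 4] and the polar body
    stops at [1 / (1 + (1 - b) a s / 2)]. *)
Lemma distance_tradeoff2 (s a eps b : R) : 0 < s -> 0 < eps -> 0 < a -> 0 <= b ->
  a * s <= 2 -> a * b <= eps ->
  1 + (a / 2 - eps) * s <= (1 - eps / 4 * s) * (1 + a * s / 2 * (1 - b)).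
Proof.
move=> s0 e0 a0 b0 as2 ab.
have h1 : 0 <= (eps - a * b) * s by apply: mulr_ge0; lra.
have h2 : 0 <= eps * s * (2 - a * s).
  by apply: mulr_ge0; [rewrite mulr_ge0// ltW|lra].
have h3 : 0 <= eps * s * (a * s * b) by rewrite !mulr_ge0// ltW.
lra.
Qed.
End distance_bounds.

Section cube_cuts.
Context {R : realType}.
Variables (n : nat) (d : R) (e u x : 'rV[R]_n) (c : R).
Hypotheses (n0 : (0 < n)%N) (u0 : u != 0) (e1 : sign_vector e).
Hypothesis eu : forall i, e 0 i * u 0 i = `|u 0 i|.
Hypothesis xc : c <= dot x u.
Hypothesis t2 : forall i, `|x 0 i| <= 1.
Let t i := 1 - e 0 i * x 0 i.

Let t_le2 i : t i <= 2.
Proof.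
rewrite /t; have : `|e 0 i * x 0 i| <= 1 by rewrite normrM e1 mul1r.
by rewrite ler_norml => /andP[]; lra.
Qed.

Let cut T : 0 <= d -> (forall i, 0 < t i) -> \sum_i t i <= T ->
  n`!%:R * 2 ^+ n * d * (1 + T / 2) ^+ n < n%:R ^+ n * \prod_i t i ->
  (d%:E * volume (cube R n) < volume (cube R n `&` halfspace_neg u c))%E.
Proof.
move=> d0 t0 tT H; apply: lt_le_trans (volume_cube_cut n0 u0 e1 eu t0 xc).
have f0 : 0 < n`!%:R :> R by rewrite ltr0n fact_gt0.
have s0 : 0 <= \sum_i t i by apply: sumr_ge0 => i _; exact: ltW.
have p0 : 0 < (1 + (\sum_i t i) / 2) ^+ n by apply: exprn_gt0; lra.
rewrite volume_cube -EFinM lte_fin ltr_pdivlMr; last by rewrite mulr_gt0.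
apply: le_lt_trans H.
have : (1 + (\sum_i t i) / 2) ^+ n <= (1 + T / 2) ^+ n.
  by rewrite lerXn2r ?nnegrE//; lra.
have d1 : 0 <= n`!%:R * 2 ^+ n * d by rewrite !mulr_ge0// exprn_ge0.
by move=> /(ler_wpM2l d1); apply: le_trans; rewrite le_eqVlt; apply/orP; left; apply/eqP; ring.
Qed.

(** If the distances [t_i] to the facets are bounded below separately, then
    [1 + n] is a crude bound for one plus half their sum; this is enough when their
    product is of larger order than [d]. *)
Lemma cube_cut_far (tau : 'I_n -> R) : 0 <= d -> (forall i, 0 < tau i <= t i) ->
  n`!%:R * 2 ^+ n * d * (1 + n%:R) ^+ n < n%:R ^+ n * \prod_i tau i ->
  (d%:E * volume (cube R n) < volume (cube R n `&` halfspace_neg u c))%E.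
Proof.
move=> d0 tt H; apply: (@cut (2 * n%:R)) => //.
- by move=> i; have /andP[h1 h2] := tt i; exact: lt_le_trans h2.
- have <- : \sum_(i < n) (2 : R) = 2 * n%:R by rewrite sumr_const card_ord mulr_natr.
  by apply: ler_sum => i _; exact: t_le2.
have -> : 2 * n%:R / 2 = n%:R :> R by field.
apply: (lt_le_trans H); rewrite ler_wpM2l ?exprn_ge0//.
by apply: ler_prod => i _; have /andP[h1 ->] := tt i; rewrite ltW.
Qed.

(** If all distances to the facets are small, the bound is asymptotically sharp. *)
Lemma cube_cut_near h tau eta : 0 <= h -> (n%:R * h) ^+ n = n`!%:R * 2 ^+ n * d -> 0 <= d ->
  (forall i, tau <= t i <= eta) -> 0 <= eta -> h * (1 + n%:R * eta / 2) < tau ->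
  (d%:E * volume (cube R n) < volume (cube R n `&` halfspace_neg u c))%E.
Proof.
move=> h0 hd d0 tt eta0 ht.
have nR : 0 < n%:R :> R by rewrite ltr0n.
have s0 : 0 <= h * (1 + n%:R * eta / 2).
  by rewrite mulr_ge0// addr_ge0// divr_ge0// mulr_ge0// ltW.
have tau0 : 0 < tau by exact: le_lt_trans ht.
apply: (@cut (n%:R * eta)) => //.
- by move=> i; have /andP[h1 h2] := tt i; exact: lt_le_trans h1.
- have <- : \sum_(i < n) eta = n%:R * eta by rewrite sumr_const card_ord mulr_natl.
  by apply: ler_sum => i _; have /andP[] := tt i.
apply: (@lt_le_trans _ _ (n%:R ^+ n * tau ^+ n)); last first.
  rewrite ler_pM2l ?exprn_gt0//.
  have -> : tau ^+ n = \prod_(i < n) tau by rewrite prodr_const card_ord.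
  by apply: ler_prod => i _; have /andP[h1 _] := tt i; rewrite ltW.
have ht' : n%:R * h * (1 + n%:R * eta / 2) < n%:R * tau by rewrite -[ltLHS]mulrA ltr_pM2l.
have nh0 : 0 <= n%:R * h * (1 + n%:R * eta / 2) by rewrite -mulrA mulr_ge0// ltW.
by rewrite -hd -!exprMn (ltrXn2r n nh0 ht') -lt0n.
Qed.
End cube_cuts.

(** * The distance for the cube *)

Section cube_distance.
Context {R : realType}.
Variables (n : nat).
Hypothesis n2 : (2 <= n)%N.

Let n0 : (0 < n)%N. Proof. exact: leq_trans n2. Qed.
Let nR : 0 < n%:R :> R. Proof. by rewrite ltr0n. Qed.
Let k0 : 'I_n := Ordinal n0.
Let ones : 'rV[R]_n := const_mx 1.

(** A point at height [q] above the facet [e] of the cross-polytope, as close to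
    its vertex [e_k] as possible while no other facet is visible: every product
    of coordinates [e_i p_i] is at least [q / 2]. *)
Definition facet_point (e : 'rV[R]_n) (k : 'I_n) (q : R) : 'rV[R]_n :=
  (q / 2) *: e + ((1 + q - n%:R * q / 2) * e 0 k) *: delta_mx 0 k.

Lemma dot_facet_point e k q x : dot (facet_point e k q) x =
  q / 2 * dot e x + (1 + q - n%:R * q / 2) * (e 0 k * x 0 k).
Proof. by rewrite dotDl !dotZl [dot (delta_mx _ _) _]dotC dot_delta mulrA. Qed.

Lemma dot_sign_sign (e : 'rV[R]_n) : sign_vector e -> dot e e = n%:R.
Proof.
move=> e1; rewrite /dot (eq_bigr (fun=> 1)).
  by rewrite sumr_const card_ord.
by move=> i _; exact: sign_sqr.
Qed.

Lemma illumination_facet_point e k q d' : sign_vector e -> 0 < q -> n%:R * q <= 2 ->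
  q = 2 ^+ n * d' -> illumination_body (cross_polytope R n) d' (facet_point e k q).
Proof.
move=> e1 q0 nq qd.
have de : dot (facet_point e k q) e = 1 + q.
  by rewrite dot_facet_point dot_sign_sign// (sign_sqr (e1 k)); field.
apply: (illumination_cross_test e1); first by rewrite de -qd; apply/andP; split; lra.
move=> i; rewrite de; have -> : e 0 i * facet_point e k q 0 i =
    q / 2 * (e 0 i * e 0 i) + (1 + q - n%:R * q / 2) * (e 0 i * e 0 k) * (i == k)%:R.
  by rewrite !mxE/=; ring.
rewrite (sign_sqr (e1 i)); have [->|ik] := eqVneq i k; last by rewrite mulr0; lra.
by rewrite (sign_sqr (e1 k)) !mulr1; lra.
Qed.

Let sign_ones : sign_vector ones.
Proof. by move=> i; rewrite mxE normr1. Qed.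

Lemma cube_distance_ge (a eps : R) : 0 < a -> (n%:R * a) ^+ n = n`!%:R * 2 ^+ n ->
  0 < eps <= a -> exists2 s0, 0 < s0 & forall s, 0 < s < s0 ->
  ((1 + (a / 2 - eps) * s)%:E <= dist_floating_illumination (cube R n) (s ^+ n))%E.
Proof.
move=> a0 an /andP[e0 ea].
pose eta := eps / (a * n%:R).
have eta0 : 0 < eta by rewrite divr_gt0// mulr_gt0.
have neta : n%:R * eta <= 1.
  have -> : n%:R * eta = eps / a by rewrite /eta; field; rewrite !gt_eqF.
  by rewrite ler_pdivrMr// mul1r.
have n2R : 2 <= n%:R :> R by rewrite ler_nat.
have eta1 : eta <= 2^-1 by nra.
pose A := n%:R ^+ n * (eps / 4 * eta ^+ n.-1).
have A0 : 0 < A by rewrite !mulr_gt0 ?invr_gt0 ?exprn_gt0.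
pose B := n`!%:R * 2 ^+ n * (1 + n%:R) ^+ n : R.
have B0 : 0 < B by rewrite !mulr_gt0 ?exprn_gt0 ?addr_gt0 ?ltr0n ?fact_gt0.
exists (Num.min (Num.min 1 (A / B)) (Num.min ((a * n%:R)^-1) (eps^-1))).
  by rewrite !lt_min ltr01 divr_gt0// !invr_gt0 mulr_gt0.
move=> s; rewrite !lt_min => /andP[s0 /andP[/andP[s1 sAB] /andP[sa se]]].
have san : a * n%:R * s < 1 by rewrite mulrC -ltr_pdivlMr ?mulr_gt0// div1r.
have ses : eps * s < 1 by rewrite mulrC -ltr_pdivlMr// div1r.
have sBA : B * s < A by rewrite mulrC -ltr_pdivlMr.
have as0 : 0 < a * s by exact: mulr_gt0.
have as1 : 2 * (a * s) < 1 by nra.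
have d0 : 0 < s ^+ n by exact: exprn_gt0.
have hd : (n%:R * (a * s)) ^+ n = n`!%:R * 2 ^+ n * s ^+ n.
  by rewrite mulrA exprMn an.
apply: dist_floating_illumination_ge => d' al d'0 al1 FP PF.
pose q := a * s / 2; have q0 : 0 < q by rewrite divr_gt0.
have tn0 : 0 < 2 ^+ n :> R by exact: exprn_gt0.
rewrite /polar_illumination_body polar_cube in FP PF.
have [dd|dd] := leP d' (q / 2 ^+ n).
  (* The illumination body is small: compare in the direction of the vertex. *)
  have qd : 2 ^+ n * d' <= q by rewrite mulrC -ler_pdivlMr.
  have Pv : polar (illumination_body (cross_polytope R n) d') ((1 + q)^-1 *: ones).
    move=> z Iz; rewrite dotC dotZl dotC ler_pdivrMl; last by lra.
    have := illumination_cross_dot sign_ones Iz (ltW d'0); lra.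
  have [z Fz zE] := PF _ Pv.
  have := floating_cube_cap n0 as0 hd Fz.
  rewrite -/ones => zc.
  have : dot ((1 + q)^-1 *: ones) ones = al * dot z ones by rewrite -zE dotZl.
  rewrite dotZl dot_sign_sign// => dE.
  have : (1 + q)^-1 <= al * (1 - 2 * q).
    rewrite -(ler_pM2r nR) dE -mulrA ler_pM2l; last by lra.
    by apply: (le_trans zc); rewrite /q mulrC; lra.
  have q1 : 2 * q < 1 by rewrite /q; lra.
  by move=> /(distance_tradeoff1 (ltW q0) q1); rewrite /q; have := mulr_gt0 e0 s0; lra.
(* The illumination body is large: compare in the direction of a point [w] that
   stays on one facet only, at distance [eta] from the others. A hyperplane cuts
   there a corner of volume of order [h] at depth [h], not [h^n], so the floating
   body comes [eps / 4 * s] close. *)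
pose w : 'rV[R]_n := (1 - eta) *: ones + eta *: delta_mx 0 k0.
pose x := (1 - eps / 4 * s) *: w.
have es4 : 0 < 1 - eps / 4 * s by lra.
have es40 : 0 < eps / 4 * s by rewrite mulr_gt0// divr_gt0.
have wi i : w 0 i = if i == k0 then 1 else 1 - eta.
  by rewrite !mxE/=; case: (i == k0) => /=; ring.
have w0 i : 0 <= w 0 i <= 1 by rewrite wi; case: ifP => _; apply/andP; split; lra.
pose tau (i : 'I_n) := if i == k0 then eps / 4 * s else eta.
have xw i : 0 <= x 0 i <= 1 - tau i.
  rewrite /x mxE /tau; have /andP[w1 w2] := w0 i; apply/andP; split;
      first by rewrite mulr_ge0// ltW.
  by move: w1 w2; rewrite wi; case: ifP => _; nra.
have Fx : floating_body (cube R n) (s ^+ n) x.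
  apply: floating_body_mem => u c u0 cx.
  apply: (cube_cut_far n0 u0 (sign_vector_signs u) _ (ltW cx) _ (tau := tau)).
  - exact: signsM.
  - move=> i; have /andP[x0 x1] := xw i; rewrite ger0_norm//; apply: (le_trans x1).
    by rewrite /tau; case: ifP => _; lra.
  - exact: ltW.
  - move=> i; have /andP[x0 x1] := xw i; apply/andP; split.
      by rewrite /tau; case: ifP.
    have := ler_norm (signs u 0 i * x 0 i);
        rewrite normrM sign_vector_signs mul1r (ger0_norm x0); lra.
  have -> : \prod_i tau i = eps / 4 * s * eta ^+ n.-1.
    rewrite (bigD1 k0)//= /tau eqxx (eq_bigr (fun=> eta)); last by move=> i /negbTE ->.
    rewrite prodr_const (_ : #|_| = n.-1)//; have := cardC1 k0; rewrite card_ord => <-;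
        exact: eq_card.
  have -> : n`!%:R * 2 ^+ n * s ^+ n * (1 + n%:R) ^+ n = B * s ^+ n by rewrite /B; ring.
  have -> : n%:R ^+ n * (eps / 4 * s * eta ^+ n.-1) = A * s by rewrite /A; ring.
  apply: (@le_lt_trans _ _ (B * s * s)); last by rewrite ltr_pM2r.
  rewrite -mulrA ler_pM2l// -expr2; apply: ler_wiXn2l => //; exact: ltW.
have Px : polar (illumination_body (cross_polytope R n) d') (al^-1 *: x).
  by apply: FP; exists x.
have nq : n%:R * q <= 2 by rewrite /q; nra.
have qE : q = 2 ^+ n * (q / 2 ^+ n) by field; exact: lt0r_neq0.
have := Px _ (illumination_body_mono (ltW dd) (illumination_facet_point k0 sign_ones q0 nq qE)).
have al0 : 0 < al by lra.
rewrite dotC dotZl dotC ler_pdivrMl// mulr1 dotC dotZl dotC.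
have -> : dot (facet_point ones k0 q) w = 1 + q * (1 - (n%:R - 1) * eta / 2).
  rewrite dot_facet_point wi eqxx mxE /w [dot ones _]dotC dotDl !dotZl dot_sign_sign//.
  by rewrite [dot (delta_mx _ _) _]dotC dot_delta mxE; field.
apply: le_trans; apply: distance_tradeoff2 => //.
- by rewrite divr_ge0// mulr_ge0 ?ltW//; lra.
- by lra.
have -> : a * ((n%:R - 1) * eta / 2) = eps * ((n%:R - 1) / n%:R) / 2.
  by rewrite /eta; field; rewrite !gt_eqF.
have : (n%:R - 1) / n%:R <= 1 :> R by rewrite ler_pdivrMr// mul1r; lra.
by nra.
Qed.
Lemma cube_distance_le (a eps : R) : 0 < a -> (n%:R * a) ^+ n = n`!%:R * 2 ^+ n ->
  0 < eps <= a -> exists2 s0, 0 < s0 & forall s, 0 < s < s0 ->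
  (dist_floating_illumination (cube R n) (s ^+ n) <= (1 + (a / 2 + eps) * s)%:E)%E.
Proof.
move=> a0 an /andP[e0 ea].
have n2R : 2 <= n%:R :> R by rewrite ler_nat.
pose g := a / 2 + eps; have g0 : 0 < g by rewrite /g; lra.
pose eta := eps / (4 * a * n%:R).
have eta0 : 0 < eta by rewrite divr_gt0// !mulr_gt0.
have naeta : n%:R * (a * eta) = eps / 4 by rewrite /eta; field; rewrite !gt_eqF.
have eta1 : eta <= 1.
  rewrite /eta ler_pdivrMr ?mulr_gt0// mul1r.
  have := mulr_ge0 (ltW a0) (_ : 0 <= n%:R - 2); rewrite subr_ge0 => /(_ n2R); lra.
pose A := n%:R ^+ n * (eta * (a / 4) ^+ n.-1).
have a4 : 0 < a / 4 by rewrite divr_gt0.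
have A0 : 0 < A.
  by apply: mulr_gt0; [exact: exprn_gt0|apply: mulr_gt0 => //; exact: exprn_gt0].
pose B := n`!%:R * 2 ^+ n * (1 + n%:R) ^+ n : R.
have B0 : 0 < B by rewrite !mulr_gt0 ?exprn_gt0 ?addr_gt0 ?ltr0n ?fact_gt0.
exists (Num.min (Num.min (eps / (4 * g ^+ 2)) (A / B)) (Num.min ((a * n%:R)^-1) (g^-1))).
  by rewrite !lt_min !divr_gt0 ?mulr_gt0 ?exprn_gt0 ?invr_gt0 ?mulr_gt0.
move=> s; rewrite !lt_min => /andP[s0 /andP[/andP[s1 sAB] /andP[sa sg]]].
have san : a * n%:R * s < 1 by rewrite mulrC -ltr_pdivlMr ?mulr_gt0// div1r.
have gs1 : g * s < 1 by rewrite mulrC -ltr_pdivlMr// div1r.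
have sBA : B * s < A by rewrite mulrC -ltr_pdivlMr.
have ggs : g ^+ 2 * s < eps / 4.
  by move: s1; rewrite ltr_pdivlMr ?mulr_gt0 ?exprn_gt0//; lra.
have as0 : 0 < a * s by exact: mulr_gt0.
have gs0 : 0 < g * s by exact: mulr_gt0.
have d0 : 0 <= s ^+ n by apply: exprn_ge0; exact: ltW.
have hd : (n%:R * (a * s)) ^+ n = n`!%:R * 2 ^+ n * s ^+ n.
  by rewrite mulrA exprMn an.
pose q := a * s / 2; have q0 : 0 < q by rewrite divr_gt0.
have tn0 : 0 < 2 ^+ n :> R by exact: exprn_gt0.
have nq : n%:R * q <= 2 by rewrite /q; lra.
have qE : q = 2 ^+ n * (q / 2 ^+ n) by field; exact: lt0r_neq0.
set d' := q / 2 ^+ n in qE; have d'0 : 0 < d' by exact: divr_gt0.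
rewrite -/g; set al := 1 + g * s; have al0 : 0 < al by rewrite /al; lra.
have qal : 1 + q <= al by rewrite /al /q /g; have := mulr_gt0 e0 s0; lra.
have ali : al^-1 <= 1 - g * s + (g * s) ^+ 2 by apply: inv_le_quadratic; exact: ltW.
have ali1 : al^-1 <= 1 - a / 4 * s.
  rewrite -div1r ler_pdivrMr// /al.
  have : 0 <= (1 - g * s) * (a * s) by rewrite mulr_ge0 ?(ltW as0)//; lra.
  have := mulr_gt0 e0 s0; rewrite /g; lra.
apply: (dist_floating_illumination_le d'0); rewrite ?/polar_illumination_body ?polar_cube.
- by rewrite /al; lra.
- move=> _ [x Fx <-] z Iz.
  have xi i : `|x 0 i| <= 1.
    rewrite -signsM -(dot_delta x) dotC -dotZl dotC.
    apply: floating_body_halfspace Fx => //.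
      apply/eqP => /rowP/(_ i)/eqP; rewrite !mxE !eqxx mulr1.
      by case: ifP; rewrite ?oppr_eq0 oner_eq0.
    move=> y /cubeP y1; rewrite dotC dotZl dotC dot_delta.
    by rewrite (le_trans _ (y1 i))// ler_sign_norm// sign_vector_signs.
  rewrite dotC dotZl dotC ler_pdivrMl// mulr1; apply: le_trans qal.
  apply: (@le_trans _ _ (l1norm z)).
    by apply: ler_sum => i _; rewrite (le_trans (ler_norm _))// normrM ler_piMr.
  have := illumination_cross_dot (sign_vector_signs z) Iz (ltW d'0).
  by rewrite dot_signs -qE.
move=> x Px; exists (al^-1 *: x); last by rewrite scalerA divff ?gt_eqF// scale1r.
have xi i : `|x 0 i| <= 1.
  rewrite -signsM -(dot_delta x) dotC -dotZl; apply: Px.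
  apply: (illumination_body_sub (@convex_cross_polytope _ _) (ltW d'0)).
  by rewrite /cross_polytope/= -[\sum_i _]/(l1norm _) l1norm_delta sign_vector_signs.
set y := al^-1 *: x.
have yi i : `|y 0 i| <= al^-1.
  by rewrite mxE normrM gtr0_norm ?invr_gt0// ler_piMr// invr_ge0 ltW.
apply: floating_body_mem => u c u0 cy.
pose e := signs u; have e1 := sign_vector_signs u.
have y1 i : `|y 0 i| <= 1 by apply: (le_trans (yi i)); have := mulr_gt0 a0 s0; lra.
have eyi i : e 0 i * y 0 i <= al^-1.
  by apply: (le_trans (ler_sign_norm _ (e1 i))).
(* Close to the vertex [e], the constraints of all the facet points over [e] keep
   [y] at distance nearly [a s] from each facet through the vertex. Elsewhere the
   crude bound suffices. *)
have [all_near|] := pselect (forall i, 1 - e 0 i * y 0 i <= eta).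
  pose tau := (a + eps) * s - n%:R * (a * eta) * s - (g * s) ^+ 2.
  apply: (cube_cut_near n0 u0 e1 (signsM u) (ltW cy) (h := a * s) (tau := tau) (eta := eta)) =>
      //.
  - exact: ltW.
  - move=> j; rewrite all_near andbT -/e.
    have := Px _ (illumination_facet_point j e1 q0 nq qE); rewrite dot_facet_point.
    have xE i : x 0 i = al * y 0 i by rewrite mxE mulrA divff ?gt_eqF// mul1r.
    have -> : dot e x = al * \sum_i e 0 i * y 0 i.
      by rewrite mulr_sumr; apply: eq_bigr => i _; rewrite xE; ring.
    rewrite xE => H.
    have {}H : q / 2 * (\sum_i e 0 i * y 0 i) + (1 + q - n%:R * q / 2) * (e 0 j * y 0 j) <= al^-1.
      by rewrite -[leRHS]mulr1 ler_pdivlMl//; move: H; lra.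
    have S : n%:R * (1 - eta) <= \sum_i e 0 i * y 0 i.
      have <- : \sum_(i < n) (1 - eta) = n%:R * (1 - eta) by rewrite sumr_const card_ord
          mulr_natl.
      by apply: ler_sum => i _; have := all_near i; lra.
    have S' : q / 2 * (n%:R * (1 - eta)) <= q / 2 * \sum_i e 0 i * y 0 i.
      by rewrite ler_wpM2l// divr_ge0// ltW.
    set t := 1 - e 0 j * y 0 j.
    have ty : e 0 j * y 0 j = 1 - t by rewrite /t; ring.
    have teta : t <= eta by exact: all_near.
    have t0 : 0 <= t by rewrite /t; have := eyi j; have := mulr_gt0 a0 s0; lra.
    rewrite ty in H.
    have h1 : 0 <= q * (eta - t) by apply: mulr_ge0; lra.
    have h2 : 0 <= n%:R * q * t by apply: mulr_ge0 => //; apply: mulr_ge0; exact: ltW.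
    have h3 : 0 <= (n%:R - 2) * (q * eta).
      by apply: mulr_ge0; [lra|apply: mulr_ge0; exact: ltW].
    have h6 : 0 <= n%:R * (q * eta) by apply: mulr_ge0 => //; apply: mulr_ge0; exact: ltW.
    have h4 : n%:R * (a * eta) * s = 2 * (n%:R * (q * eta)) by rewrite /q; field.
    have h5 : (a + eps) * s = q + g * s by rewrite /q /g; field.
    rewrite /tau h4 h5; move: H S' ali h1 h2 h3; rewrite /al.
    lra.
  - exact: ltW.
  - rewrite /tau naeta.
    have : a * s * (1 + n%:R * eta / 2) = a * s + n%:R * (a * eta) * s / 2 by ring.
    rewrite naeta => ->; rewrite expr2.
    have : (eps / 4 - g ^+ 2 * s) * s > 0 by rewrite mulr_gt0// subr_gt0.
    have := mulr_gt0 e0 s0; rewrite expr2; lra.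
move=> /existsNP[k /negP]; rewrite -ltNge => tk.
pose tau (i : 'I_n) := if i == k then eta else a / 4 * s.
apply: (cube_cut_far n0 u0 e1 (signsM u) (ltW cy) y1 (tau := tau)) => //.
  move=> i; rewrite /tau -/e; case: eqP => [->|_]; first by rewrite eta0 ltW.
  have : 0 < a / 4 * s by rewrite !mulr_gt0// invr_gt0.
  by move=> ->/=; have := eyi i; lra.
have -> : \prod_i tau i = eta * (a / 4 * s) ^+ n.-1.
  rewrite (bigD1 k)//= /tau eqxx (eq_bigr (fun=> a / 4 * s)); last by move=> i /negbTE ->.
  rewrite prodr_const (_ : #|_| = n.-1)//; have := cardC1 k; rewrite card_ord => <-;
      exact: eq_card.
have -> : n`!%:R * 2 ^+ n * s ^+ n * (1 + n%:R) ^+ n = B * s * s ^+ n.-1.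
  by rewrite -{3}(prednK n0) exprS /B; ring.
have -> : n%:R ^+ n * (eta * (a / 4 * s) ^+ n.-1) = A * s ^+ n.-1.
  by rewrite /A exprMn; ring.
by rewrite ltr_pM2r// exprn_gt0.
Qed.
End cube_distance.

(** * The distance for the cross-polytope *)

Section cross_distance.
Context {R : realType}.
Variables (m : nat).
Hypothesis m0 : (0 < m)%N.
Local Notation n := m.+1.

Let nR : 0 < n%:R :> R. Proof. by rewrite ltr0n. Qed.
Let n2R : 2 <= n%:R :> R. Proof. by rewrite ler_nat. Qed.

Lemma l1normD k (x y : 'rV[R]_k) : l1norm (x + y) <= l1norm x + l1norm y.
Proof. by rewrite /l1norm -big_split; apply: ler_sum => i _; rewrite mxE ler_normD. Qed.

Lemma illumination_cube_facet_point (e : 'rV[R]_n) (i : 'I_n) q d' : sign_vector e ->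
  0 < q -> q = 2 * n%:R * d' ->
  illumination_body (cube R n) d' (e + (q * e 0 i) *: delta_mx 0 i).
Proof.
move=> e1 q0 qd; apply: (illumination_cube_test (i := i) (e1 i)).
  have -> : e 0 i * (e + (q * e 0 i) *: delta_mx 0 i) 0 i = 1 + q.
    by rewrite !mxE !eqxx mulr1 mulrDr mulrCA (sign_sqr (e1 i)) mulr1.
  by rewrite -qd lexx andbT ltrDl.
by move=> j ji; rewrite !mxE (negbTE ji) andbF mulr0 addr0 e1.
Qed.

Lemma dot_cube_facet_point (e : 'rV[R]_n) (i : 'I_n) q x :
  dot (e + (q * e 0 i) *: delta_mx 0 i) x = dot e x + q * (e 0 i * x 0 i).
Proof. by rewrite dotDl dotZl [dot (delta_mx _ _) _]dotC dot_delta mulrA. Qed.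

Let B : R := 2 ^+ n / n`!%:R.
Let B0 : 0 < B. Proof. by rewrite divr_gt0 ?exprn_gt0 ?ltr0n ?fact_gt0. Qed.

(** In dimension [n] a cut of volume of order [s^(n-1)] exceeds [s^n], up to
    constants, as soon as [s] is small. *)
Lemma cross_edge_cut (i j : 'I_n) mm th s (x : 'rV[R]_n) u c :
  i != j -> 0 < mm -> mm <= `|x 0 i| -> mm <= `|x 0 j| ->
  0 < th -> 0 < s -> th * s / n%:R <= mm / 2 -> l1norm x <= 1 - th * s ->
  B * s < mm / 2 * (2 * (th / n%:R)) ^+ m -> c < dot x u ->
  ((s ^+ n)%:E * volume (cross_polytope R n) <
    volume (cross_polytope R n `&` halfspace_neg u c))%E.
Proof.
move=> ij mm0 xi xj th0 s0 tm x1 Bs cx.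
have ths : 0 < th * s by exact: mulr_gt0.
apply: lt_le_trans (volume_cross_edge_cut ij mm0 xi xj ths tm x1 cx).
rewrite volume_cross_polytope -EFinM lte_fin -/B /=.
have -> : mm / 2 * (2 * (th * s / n%:R)) ^+ m = mm / 2 * (2 * (th / n%:R)) ^+ m * s ^+ m.
  have -> : 2 * (th * s / n%:R) = 2 * (th / n%:R) * s by ring.
  by rewrite [(_ * s) ^+ m]exprMn -[RHS]mulrA.
by rewrite exprS mulrAC [s * B]mulrC ltr_pM2r// exprn_gt0.
Qed.

Lemma cross_distance_ge (a eps : R) : 0 < a -> a ^+ n = 2 ->
  0 < eps <= a -> exists2 s0, 0 < s0 & forall s, 0 < s < s0 ->
  ((1 + (a / 2 - eps) * s)%:E <= dist_floating_illumination (cross_polytope R n) (s ^+ n))%E.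
Proof.
move=> a0 an /andP[e0 ea].
pose eta := eps / (2 * a).
have eta0 : 0 < eta by rewrite divr_gt0// mulr_gt0.
have aeta : a * eta = eps / 2 by rewrite /eta; field; rewrite gt_eqF.
have eta1 : eta <= 2^-1 by rewrite /eta ler_pdivrMr ?mulr_gt0//; lra.
pose A := eta / 2 / 2 * (2 * (eps / 4 / n%:R)) ^+ m.
have A0 : 0 < A.
  apply: mulr_gt0; first by apply: divr_gt0 => //; exact: divr_gt0.
  by apply: exprn_gt0; apply: mulr_gt0 => //; apply: divr_gt0 => //; exact: divr_gt0.
exists (Num.min (Num.min (eta / eps) (A / B)) (Num.min ((2 * a)^-1) (eps^-1))).
  rewrite !lt_min !invr_gt0 (divr_gt0 eta0 e0) (divr_gt0 A0 B0) e0 /=.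
  by rewrite mulr_gt0.
move=> s; rewrite !lt_min => /andP[s0 /andP[/andP[s1 sAB] /andP[sa se]]].
have sa2 : 2 * a * s < 1 by rewrite mulrC -ltr_pdivlMr ?mulr_gt0// div1r.
have ses : eps * s < 1 by rewrite mulrC -ltr_pdivlMr// div1r.
have sBA : B * s < A by rewrite mulrC -ltr_pdivlMr.
have sees : eps * s < eta by rewrite mulrC -ltr_pdivlMr.
have as0 : 0 < a * s by exact: mulr_gt0.
have d0 : 0 < s ^+ n by exact: exprn_gt0.
have hd : (a * s) ^+ n = 2 * s ^+ n by rewrite exprMn an.
apply: dist_floating_illumination_ge => d' al d'0 al1 FP PF.
pose q := a * s / 2; have q0 : 0 < q by rewrite divr_gt0.
have nn0 : 0 < 2 * n%:R :> R by exact: mulr_gt0.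
rewrite /polar_illumination_body polar_cross_polytope in FP PF.
pose i0 : 'I_n := ord0; pose i1 : 'I_n := ord_max.
have i01 : i0 != i1 by rewrite -val_eqE /= eq_sym -lt0n.
have s11 : `|1 : R| = 1 by exact: normr1.
have [dd|dd] := leP d' (q / (2 * n%:R)).
  have qd : 2 * n%:R * d' <= q by rewrite mulrC -ler_pdivlMr.
  have Pv : polar (illumination_body (cube R n) d') ((1 + q)^-1 *: delta_mx 0 i0).
    move=> z Iz; rewrite dotC dotZl dotC dot_delta ler_pdivrMl; last by lra.
    have := illumination_cube_coord i0 s11 Iz (ltW d'0); lra.
  have [z Fz zE] := PF _ Pv.
  have zc : z 0 i0 <= 1 - a * s.
    have h01 : 0 < a * s <= 1 by apply/andP; split; lra.
    exact: floating_cross_cap h01 hd Fz.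
  have := congr1 (fun v : 'rV[R]_n => v 0 i0) zE; rewrite /= !mxE !eqxx mulr1 => dE.
  have : (1 + q)^-1 <= al * (1 - 2 * q).
    rewrite -dE ler_pM2l; last by lra.
    by apply: (le_trans zc); rewrite /q mulrC; lra.
  have q1 : 2 * q < 1 by rewrite /q; lra.
  by move=> /(distance_tradeoff1 (ltW q0) q1); rewrite /q; have := mulr_gt0 e0 s0; lra.
(* The point [w] of an edge is not a vertex, so that cuts at depth [h] have volume
   of order at least [h^(n-1)]. *)
pose w : 'rV[R]_n := (1 - eta) *: delta_mx 0 i0 + eta *: delta_mx 0 i1.
pose x := (1 - eps / 4 * s) *: w.
have es40 : 0 < eps / 4 * s by apply: mulr_gt0 => //; exact: divr_gt0.
have es4 : 2^-1 <= 1 - eps / 4 * s by lra.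
have w0 : w 0 i0 = 1 - eta by rewrite !mxE !eqxx (negbTE i01) mulr0 addr0 mulr1.
have w1 : w 0 i1 = eta.
  by rewrite !mxE !eqxx [i1 == i0]eq_sym (negbTE i01) mulr0 add0r mulr1.
have lw : l1norm w <= 1.
  by apply: (le_trans (l1normD _ _)); rewrite !l1norm_delta !ger0_norm//; lra.
have Fx : floating_body (cross_polytope R n) (s ^+ n) x.
  apply: floating_body_mem => u c u0 cx.
  apply: (cross_edge_cut (i := i0) (j := i1) (mm := eta / 2) (th := eps / 4) (x := x)) => //.
  - by rewrite divr_gt0.
  - rewrite mxE w0 normrM (@ger0_norm _ (1 - eps / 4 * s)) ?(@ger0_norm _ (1 - eta)); [|lra|lra].
    have : 2^-1 * (1 - eta) <= (1 - eps / 4 * s) * (1 - eta) by rewrite ler_wpM2r//; lra.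
    lra.
  - rewrite mxE w1 normrM (@ger0_norm _ (1 - eps / 4 * s)) ?(@ger0_norm _ eta); [|exact: ltW|lra].
    have : 2^-1 * eta <= (1 - eps / 4 * s) * eta by rewrite ler_wpM2r// ltW.
    lra.
  - by rewrite divr_gt0.
  - rewrite ler_pdivrMr//.
    have : eta / 2 / 2 * 2 <= eta / 2 / 2 * n%:R.
      by apply: ler_wpM2l => //; apply: divr_ge0 => //; apply: divr_ge0 => //; exact: ltW.
    lra.
  - rewrite l1normZ ger0_norm; last by lra.
    by rewrite ler_piMr//; lra.
have Px : polar (illumination_body (cube R n) d') (al^-1 *: x).
  by apply: FP; exists x.
pose ones : 'rV[R]_n := const_mx 1.
have sign_ones : sign_vector ones by move=> i; rewrite mxE normr1.
have qE : q = 2 * n%:R * (q / (2 * n%:R)) by field; rewrite lt0r_neq0// lt0r_neq0.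
have := Px _ (illumination_body_mono (ltW dd) (illumination_cube_facet_point i0 sign_ones q0 qE)).
have al0 : 0 < al by lra.
rewrite dotC dotZl dotC ler_pdivrMl// mulr1 dotC dotZl dotC.
have -> : dot (ones + (q * ones 0 i0) *: delta_mx 0 i0) w = 1 + q * (1 - eta).
  rewrite dot_cube_facet_point w0 mxE mul1r /w dotC dotDl !dotZl; congr (_ + _).
  by rewrite ![dot (delta_mx _ _) _]dotC !dot_delta !mxE; ring.
by apply: le_trans; apply: distance_tradeoff2 => //; [exact: ltW|lra|lra].
Qed.

Lemma cross_distance_le (a eps : R) : 0 < a -> a ^+ n = 2 ->
  0 < eps <= a -> exists2 s0, 0 < s0 & forall s, 0 < s < s0 ->
  (dist_floating_illumination (cross_polytope R n) (s ^+ n) <= (1 + (a / 2 + eps) * s)%:E)%E.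
Proof.
move=> a0 an /andP[e0 ea].
pose g := a / 2 + eps; have g0 : 0 < g by rewrite /g; lra.
pose eta := eps / (2 * a).
have eta0 : 0 < eta by rewrite divr_gt0// mulr_gt0.
have aeta : a * eta = eps / 2 by rewrite /eta; field; rewrite gt_eqF.
have eta1 : eta <= 2^-1 by rewrite /eta ler_pdivrMr ?mulr_gt0//; lra.
pose mm := eta / 2 / n%:R; have mm0 : 0 < mm by apply: divr_gt0 => //; exact: divr_gt0.
have nmm : n%:R * mm = eta / 2 by rewrite /mm; field; exact: lt0r_neq0.
pose A := mm / 2 * (2 * (a / 4 / n%:R)) ^+ m.
have A0 : 0 < A.
  apply: mulr_gt0; first by exact: divr_gt0.
  by apply: exprn_gt0; apply: mulr_gt0 => //; apply: divr_gt0 => //; exact: divr_gt0.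
exists (Num.min (Num.min (eps / (4 * g ^+ 2)) (A / B)) (Num.min (eta / (4 * a)) (g^-1))).
  rewrite !lt_min invr_gt0 (divr_gt0 A0 B0) g0 !andbT.
  by apply/andP; split; apply: divr_gt0 => //; apply: mulr_gt0 => //; exact: exprn_gt0.
move=> s; rewrite !lt_min => /andP[s0 /andP[/andP[s1 sAB] /andP[sa sg]]].
have gs1 : g * s < 1 by rewrite mulrC -ltr_pdivlMr// div1r.
have sBA : B * s < A by rewrite mulrC -ltr_pdivlMr.
have ggs : g ^+ 2 * s < eps / 4.
  by move: s1; rewrite ltr_pdivlMr ?mulr_gt0 ?exprn_gt0//; lra.
have s4 : 4 * a * s < eta by rewrite mulrC -ltr_pdivlMr ?mulr_gt0.
have as0 : 0 < a * s by exact: mulr_gt0.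
have es0 : 0 < eps * s by exact: mulr_gt0.
have eas : 0 <= (a - eps) * s by apply: mulr_ge0; [lra|exact: ltW].
have gs0 : 0 < g * s by exact: mulr_gt0.
have d0 : 0 <= s ^+ n by apply: exprn_ge0; exact: ltW.
pose q := a * s / 2; have q0 : 0 < q by rewrite divr_gt0.
have nn0 : 0 < 2 * n%:R :> R by exact: mulr_gt0.
have qE : q = 2 * n%:R * (q / (2 * n%:R)) by field; rewrite lt0r_neq0// lt0r_neq0.
set d' := q / (2 * n%:R) in qE; have d'0 : 0 < d' by exact: divr_gt0.
rewrite -/g; set al := 1 + g * s; have al0 : 0 < al by rewrite /al; lra.
have qal : 1 + q <= al by rewrite /al /q /g; lra.
have ali : al^-1 <= 1 - g * s + (g * s) ^+ 2 by apply: inv_le_quadratic; exact: ltW.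
have ali1 : al^-1 <= 1 - a / 4 * s.
  rewrite -div1r ler_pdivrMr// /al.
  have : 0 <= (1 - g * s) * (a * s) by apply: mulr_ge0; lra.
  rewrite /g; lra.
apply: (dist_floating_illumination_le d'0);
    rewrite ?/polar_illumination_body ?polar_cross_polytope.
- by rewrite /al; lra.
- move=> _ [x Fx <-] z Iz.
  have x1 : l1norm x <= 1.
    rewrite -dot_signs; apply: floating_body_halfspace Fx => //.
      apply/eqP => /rowP/(_ ord0)/eqP; rewrite !mxE.
      by case: ifP; rewrite ?oppr_eq0 oner_eq0.
    by move=> y y1; exact: le_trans (dot_sign_le _ (sign_vector_signs x)) y1.
  have zi i : `|z 0 i| <= 1 + q.
    by rewrite -signsM qE; exact: (illumination_cube_coord i (sign_vector_signs z i) Iz (ltW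
        d'0)).
  rewrite dotC dotZl dotC ler_pdivrMl// mulr1; apply: le_trans qal.
  apply: (@le_trans _ _ ((1 + q) * l1norm x)); last by rewrite ler_piMr//; lra.
  rewrite /l1norm mulr_sumr; apply: ler_sum => i _.
  by rewrite (le_trans (ler_norm _))// normrM ler_wpM2r.
move=> x Px; exists (al^-1 *: x); last by rewrite scalerA divff ?gt_eqF// scale1r.
have xi i : l1norm x + q * `|x 0 i| <= 1.
  have := Px _ (illumination_cube_facet_point i (sign_vector_signs x) q0 qE).
  by rewrite dot_cube_facet_point signsM dotC dot_signs.
have ai0 : 0 < al^-1 by rewrite invr_gt0.
set y := al^-1 *: x.
have yi i : l1norm y + q * `|y 0 i| <= al^-1.
  rewrite l1normZ mxE normrM (gtr0_norm ai0) mulrCA -mulrDr -[leRHS]mulr1.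
  by rewrite ler_pM2l.
have y1 : l1norm y <= 1 - a / 4 * s.
  apply: le_trans ali1; apply: le_trans (yi ord0); rewrite lerDl; apply: mulr_ge0 => //;
      exact: ltW.
pose tau := (a + eps / 2) * s.
(* Points of norm larger than [1 - tau] are kept away from the vertices by the
   facet points, hence have two large coordinates. *)
have [ytau|ytau] := leP (l1norm y) (1 - tau).
  apply: floating_cross_dilate ytau; first by apply/andP; rewrite /tau; split; lra.
  have -> : 2 * s ^+ n = (a * s) ^+ n by rewrite exprMn an.
  by rewrite (ltrXn2r _ (ltW as0))// /tau; lra.
have y_small i : `|y 0 i| < 1 - eta.
  have : q * `|y 0 i| < q * (1 - eta).
    have : q * eta = eps / 4 * s.
      have -> : q * eta = a * eta * s / 2 by rewrite /q; ring.
      by rewrite aeta; field.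
    rewrite mulrBr mulr1 => ->; have := yi i; move: ytau ali; rewrite expr2.
    have : 0 < (eps / 4 - g ^+ 2 * s) * s by rewrite mulr_gt0// subr_gt0.
    rewrite /tau /q /g expr2; lra.
  by rewrite ltr_pM2l.
have tau_le : tau <= eta / 2 by rewrite /tau; lra.
have sum_small (P : pred 'I_n) : (forall k, P k -> `|y 0 k| < mm) ->
    \sum_(k | P k) `|y 0 k| <= eta / 2.
  move=> Hk; rewrite -nmm; have <- : \sum_(k < n) mm = n%:R * mm by rewrite sumr_const card_ord
      mulr_natl.
  rewrite big_mkcond; apply: ler_sum => k _; case: ifP => [/Hk/ltW//|_]; exact: ltW.
have [i yim] : exists i, mm <= `|y 0 i|.
  apply/existsP; apply: contraT; rewrite negb_exists => /forallP H.
  have : l1norm y <= eta / 2 by apply: sum_small => k _; have := H k; rewrite -ltNge.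
  lra.
have [j ij yjm] : exists2 j, i != j & mm <= `|y 0 j|.
  suff /existsP[j /andP[? ?]] : [exists j, (i != j) && (mm <= `|y 0 j|)] by exists j.
  apply: contraT; rewrite negb_exists => /forallP H.
  have : l1norm y <= `|y 0 i| + eta / 2.
    rewrite /l1norm (bigD1 i)//= lerD2l; apply: sum_small => k ki.
    by have := H k; rewrite eq_sym ki /= -ltNge.
  have := y_small i; lra.
apply: floating_body_mem => u c u0 cy.
apply: (cross_edge_cut ij mm0 yim yjm (th := a / 4)) cy => //.
- by rewrite divr_gt0.
rewrite ler_pdivrMr// [mm / 2 * _](_ : _ = n%:R * mm / 2); last by ring.
by rewrite nmm; lra.
Qed.
End cross_distance.

(** * The limits *)

Section limits.
Context {R : realType}.

Lemma powR_root (x : R) n : (0 < n)%N -> 0 <= x -> (x `^ n%:R^-1) ^+ n = x.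
Proof.
move=> n0 x0; rewrite -powR_mulrn ?powR_ge0// -powRrM mulVf ?powRr1//.
by rewrite pnatr_eq0 -lt0n.
Qed.

(** Substituting [delta = s ^ n] turns the limit into first-order bounds in [s]. *)
Lemma limit_from_bounds n (F : R -> \bar R) (l a : R) : (0 < n)%N -> 0 < a ->
  (forall eps, 0 < eps <= a -> exists2 s0, 0 < s0 & forall s, 0 < s < s0 ->
    ((1 + (l - eps) * s)%:E <= F (s ^+ n)%R)%E) ->
  (forall eps, 0 < eps <= a -> exists2 s0, 0 < s0 & forall s, 0 < s < s0 ->
    (F (s ^+ n)%R <= (1 + (l + eps) * s)%:E)%E) ->
  ((F delta - 1) / (delta `^ n%:R^-1)%:E)%E @[delta --> (0 : R)^'+] --> l%:E.
Proof.
move=> n0 a0 lo up.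
have bounds eps : 0 < eps <= a -> \forall delta \near (0 : R)^'+, exists f s,
    [/\ 0 < s, F delta = f%:E, delta `^ n%:R^-1 = s &
        1 + (l - eps) * s <= f <= 1 + (l + eps) * s].
  move=> ea; have [s1 s10 H1] := lo _ ea; have [s2 s20 H2] := up _ ea.
  have s120 : 0 < Num.min s1 s2 by rewrite lt_min s10.
  near=> delta; have d0 : 0 < delta by near: delta; exact: nbhs_right_gt.
  pose s := delta `^ n%:R^-1; have s0 : 0 < s by exact: powR_gt0.
  have sd : s ^+ n = delta by apply: powR_root => //; exact: ltW.
  have s12 : s < Num.min s1 s2.
    rewrite ltNge; apply/negP => /(@lerXn2r _ n _ _ _ _).
    rewrite !nnegrE (ltW s120) (ltW s0) sd => /(_ isT isT); apply/negP; rewrite -ltNge.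
    by near: delta; apply: nbhs_right_lt; exact: exprn_gt0.
  move: s12; rewrite lt_min => /andP[ss1 ss2].
  have := H1 s; rewrite s0 ss1 sd => /(_ isT) h1.
  have := H2 s; rewrite s0 ss2 sd => /(_ isT) h2.
  move: h1 h2; case: (F delta) => [f| |]//.
  by rewrite !lee_fin => h1 h2; exists f, s; split => //; apply/andP.
have quot (f s : R) : 0 < s -> ((f%:E - 1) / s%:E)%E = ((f - 1) / s)%:E.
  by move=> s0; rewrite inver gt_eqF.
apply/fine_cvgP; split.
  have ea : 0 < a <= a by rewrite a0 lexx.
  near=> delta; have [f [s [s0 -> -> _]]] : exists f s,
    [/\ 0 < s, F delta = f%:E, delta `^ n%:R^-1 = s &
        1 + (l - a) * s <= f <= 1 + (l + a) * s] by near: delta; exact: bounds.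
  by rewrite quot.
apply/cvgrPdist_le => e e0.
have ea : 0 < Num.min e a <= a by rewrite lt_min e0 a0 ge_min lexx orbT.
near=> delta; have [f [s [s0 Ff sE /andP[fl fu]]]] : exists f s,
    [/\ 0 < s, F delta = f%:E, delta `^ n%:R^-1 = s &
        1 + (l - Num.min e a) * s <= f <= 1 + (l + Num.min e a) * s]
  by near: delta; exact: bounds.
rewrite /= Ff sE quot//=; apply: (@le_trans _ _ (Num.min e a)); last by rewrite ge_min lexx.
have h1 : (f - 1) / s <= l + Num.min e a by rewrite ler_pdivrMr//; lra.
have h2 : l - Num.min e a <= (f - 1) / s by rewrite ler_pdivlMr//; lra.
by rewrite ler_norml; apply/andP; split; lra.
Unshelve. all: by end_near.
Qed.
End limits.

Theorem corollary2p2 (R : realType) (n : nat) (hn : (2 <= n)%N) :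
  (((dist_floating_illumination (cube R n) delta - 1)
     / (delta `^ n%:R^-1)%:E)%E @[delta --> (0 : R)^'+]
   --> ((n`!%:R `^ n%:R^-1) / n%:R)%:E) /\
  (((dist_floating_illumination (cross_polytope R n) delta - 1)
     / (delta `^ n%:R^-1)%:E)%E @[delta --> (0 : R)^'+]
   --> ((2 `^ n%:R^-1) / 2)%:E).
Proof.
have n0 : (0 < n)%N by exact: leq_trans hn.
have nR : 0 < n%:R :> R by rewrite ltr0n.
split.
  have f0 : 0 < n`!%:R :> R by rewrite ltr0n fact_gt0.
  pose a : R := 2 * (n`!%:R `^ n%:R^-1) / n%:R.
  have a0 : 0 < a by rewrite divr_gt0// mulr_gt0// powR_gt0.
  have an : (n%:R * a) ^+ n = n`!%:R * 2 ^+ n.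
    have -> : n%:R * a = 2 * (n`!%:R `^ n%:R^-1) by rewrite /a; field; rewrite gt_eqF.
    by rewrite exprMn powR_root ?ltW// mulrC.
  have -> : n`!%:R `^ n%:R^-1 / n%:R = a / 2 by rewrite /a; field; rewrite gt_eqF.
  by apply: (limit_from_bounds n0 a0) => eps; [exact: cube_distance_ge|exact: cube_distance_le].
case: n hn n0 nR => [//|m] hn n0 nR.
pose a : R := 2 `^ m.+1%:R^-1; have a0 : 0 < a by exact: powR_gt0.
have an : a ^+ m.+1 = 2 by exact: powR_root.
by apply: (limit_from_bounds n0 a0) => eps; [exact: cross_distance_ge|exact: cross_distance_le].
Qed.
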